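(* Let $F$ be a commutative field of characteristic $\neq 2$ and let $\mathcal{E}$ be a power-associative evolution algebra over $F$ of dimension $5$. Then $\mathcal{E}$ is isomorphic to one and only one of the following algebras (an entry with parameters being a family, in which the parameters take some admissible values). Each algebra is given on a basis $e_1,\ldots,e_5$ with $e_ie_j=0$ for $i\ne j$, and squares $e_i^2$ that are not listed are zero; all parameters $\alpha,\beta,\gamma$ are in $F^*$. $N_{5,1}$: all products zero; $N_{5,2}$: $e_1^2=e_2$; $N_{5,3}(\alpha)$: $e_1^2=e_3$, $e_2^2=\alpha e_3$; $N_{5,4}$: $e_1^2=e_2$, $e_3^2=e_4$; $N_{5,5}(\alpha,\beta)$: $e_1^2=e_4$, $e_2^2=\alpha e_4$, $e_3^2=\beta e_4$; $N_{5,6}(\alpha)$: $e_1^2=e_3$, $e_2^2=\alpha e_3$, $e_4^2=e_5$; $N_{5,7}$: $e_1^2=e_2+e_3$, $e_2^2=e_4$, $e_3^2=-e_4$; $N_{5,8}(\alpha,\beta,\gamma)$: $e_1^2=e_5$, $e_2^2=\alpha e_5$, $e_3^2=\beta e_5$, $e_4^2=\gamma e_5$; $N_{5,9}(\alpha,\beta)$: $e_1^2=e_4$, $e_2^2=\alpha e_4+\beta e_5$, $e_3^2=e_5$; $N_{5,10}(\alpha)$: $e_1^2=e_2+e_3$, $e_2^2=e_5$, $e_3^2=-e_5$, $e_4^2=\alpha e_5$; $N_{5,11}(\alpha)$: $e_1^2=e_2+e_3$, $e_2^2=e_5$, $e_3^2=-e_5$, $e_4^2=\alpha(e_2+e_3)$;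 $N_{5,12}(\alpha,\beta)$: $e_1^2=e_2+e_3$, $e_2^2=e_5$, $e_3^2=-e_5$, $e_4^2=\alpha(e_2+e_3)+\beta e_5$; $\mathcal{E}_{5,13}$: $e_1^2=e_1$; $\mathcal{E}_{5,14}$: $e_1^2=e_1$, $e_2^2=e_3$; $\mathcal{E}_{5,15}(\alpha)$: $e_1^2=e_1$, $e_2^2=e_4$, $e_3^2=\alpha e_4$; $\mathcal{E}_{5,16}$: $e_1^2=e_1$, $e_2^2=e_3$, $e_4^2=e_5$; $\mathcal{E}_{5,17}(\alpha,\beta)$: $e_1^2=e_1$, $e_2^2=e_5$, $e_3^2=\alpha e_5$, $e_4^2=\beta e_5$; $\mathcal{E}_{5,18}$: $e_1^2=e_1$, $e_2^2=e_3+e_4$, $e_3^2=e_5$, $e_4^2=-e_5$; $\mathcal{E}_{5,19}$: $e_1^2=e_1$, $e_2^2=e_2$; $\mathcal{E}_{5,20}$: $e_1^2=e_1$, $e_2^2=e_2$, $e_3^2=e_4$; $\mathcal{E}_{5,21}(\alpha)$: $e_1^2=e_1$, $e_2^2=e_2$, $e_3^2=e_5$, $e_4^2=\alpha e_5$; $\mathcal{E}_{5,22}$: $e_i^2=e_i$ for $i=1,2,3$; $\mathcal{E}_{5,23}$: $e_i^2=e_i$ for $i=1,2,3$, $e_4^2=e_5$; $\mathcal{E}_{5,24}$: $e_i^2=e_i$ for $i=1,2,3,4$; $\mathcal{E}_{5,25}$: $e_i^2=e_i$ for $i=1,2,3,4,5$.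
   Context: An $n$-dimensional (not necessarily associative) algebra $\mathcal{E}$ over $F$ is an evolution algebra if it has a basis $\{e_1,\ldots,e_n\}$ (a natural basis) with $e_ie_j=0$ for all $i\neq j$ (and $e_i^2$ arbitrary); such an algebra is commutative. An algebra is power-associative if the subalgebra generated by each single element is associative. $F^*=F\setminus\{0\}$. *)

(* Defs.v *)
(* Mathematical Components.  A (not necessarily associative) finite-dimensional
   algebra over F is a vectType E over F together with an arbitrary bilinear
   product E -> E -> E. *)
From HB Require Import structures.
From mathcomp Require Import all_boot all_order all_algebra.
Set Implicit Arguments.
Unset Strict Implicit.
Unset Printing Implicit Defensive.
Import GRing.Theory.
Local Open Scope ring_scope.

Section Algebras.
Variables (F : fieldType) (E : vectType F) (mul : {bilinear E -> E -> E}).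

Definition natural_basis (b : seq E) : Prop :=
  basis_of fullv b /\
  forall i j, (i < size b)%N -> (j < size b)%N -> i != j -> mul b`_i b`_j = 0.

Definition evolution_algebra : Prop := exists b : seq E, natural_basis b.

Definition subalgebra (U : {vspace E}) : Prop :=
  forall x y, x \in U -> y \in U -> mul x y \in U.

Definition in_generated (x y : E) : Prop :=
  forall U : {vspace E}, subalgebra U -> x \in U -> y \in U.

Definition power_associative : Prop :=
  forall x a b c : E,
    in_generated x a -> in_generated x b -> in_generated x c ->
    mul (mul a b) c = mul a (mul b c).

End Algebras.

Definition alg_isomorphic (F : fieldType) (E A : vectType F)
    (mulE : {bilinear E -> E -> E}) (mulA : {bilinear A -> A -> A}) : Prop :=
  exists f : 'Hom(E, A),
    bijective f /\ forall x y, f (mulE x y) = mulA (f x) (f y).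

(* The product on F^n for which the canonical basis is natural, the square of
   its basis vector number i (counted from 0) being s`_i; hence that square is
   zero when i >= size s. *)
Definition evol_mul (F : fieldType) (n : nat) (s : seq 'rV[F]_n)
    (x y : 'rV[F]_n) : 'rV[F]_n :=
  \sum_(i < n) (x 0 i * y 0 i) *: s`_i.

Fact evol_mul_bilinear (F : fieldType) (n : nat) (s : seq 'rV[F]_n) :
  bilinear_for *:%R *:%R (@evol_mul F n s).
Proof.
split=> z a x y; rewrite /= /applyr /evol_mul scaler_sumr -big_split /=;
  apply: eq_bigr => i _; rewrite !mxE scalerA -scalerDl; congr (_ *: _).
  by rewrite mulrDl mulrA.
by rewrite mulrDr mulrCA.
Qed.

HB.instance Definition _ (F : fieldType) (n : nat) (s : seq 'rV[F]_n) :=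
  bilinear_isBilinear.Build F 'rV[F]_n 'rV[F]_n 'rV[F]_n *:%R *:%R
    (@evol_mul F n s) (evol_mul_bilinear s).

Section List.
Variable F : fieldType.

(* Basis vectors are numbered from 1 to 5. *)
Definition e (k : nat) : 'rV[F]_5 := \row_(j < 5) (j.+1 == k)%:R.

(* [listed k s]: the algebra whose squares e_1^2, e_2^2, ... are the successive
   entries of s (missing trailing entries being 0) belongs to family number k. *)
Inductive listed : nat -> seq 'rV[F]_5 -> Prop :=
| N1 : listed 1 [::]
| N2 : listed 2 [:: e 2]
| N3 (a : F) of a != 0 : listed 3 [:: e 3; a *: e 3]
| N4 : listed 4 [:: e 2; 0; e 4]
| N5 (a b : F) of a != 0 & b != 0 : listed 5 [:: e 4; a *: e 4; b *: e 4]
| N6 (a : F) of a != 0 : listed 6 [:: e 3; a *: e 3; 0; e 5]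
| N7 : listed 7 [:: e 2 + e 3; e 4; - e 4]
| N8 (a b c : F) of a != 0 & b != 0 & c != 0 :
    listed 8 [:: e 5; a *: e 5; b *: e 5; c *: e 5]
| N9 (a b : F) of a != 0 & b != 0 :
    listed 9 [:: e 4; a *: e 4 + b *: e 5; e 5]
| N10 (a : F) of a != 0 : listed 10 [:: e 2 + e 3; e 5; - e 5; a *: e 5]
| N11 (a : F) of a != 0 :
    listed 11 [:: e 2 + e 3; e 5; - e 5; a *: (e 2 + e 3)]
| N12 (a b : F) of a != 0 & b != 0 :
    listed 12 [:: e 2 + e 3; e 5; - e 5; a *: (e 2 + e 3) + b *: e 5]
| E13 : listed 13 [:: e 1]
| E14 : listed 14 [:: e 1; e 3]
| E15 (a : F) of a != 0 : listed 15 [:: e 1; e 4; a *: e 4]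
| E16 : listed 16 [:: e 1; e 3; 0; e 5]
| E17 (a b : F) of a != 0 & b != 0 :
    listed 17 [:: e 1; e 5; a *: e 5; b *: e 5]
| E18 : listed 18 [:: e 1; e 3 + e 4; e 5; - e 5]
| E19 : listed 19 [:: e 1; e 2]
| E20 : listed 20 [:: e 1; e 2; e 4]
| E21 (a : F) of a != 0 : listed 21 [:: e 1; e 2; e 5; a *: e 5]
| E22 : listed 22 [:: e 1; e 2; e 3]
| E23 : listed 23 [:: e 1; e 2; e 3; e 5]
| E24 : listed 24 [:: e 1; e 2; e 3; e 4]
| E25 : listed 25 [:: e 1; e 2; e 3; e 4; e 5].

End List.

(* Main.v *)
(* Write e_i^2 = sum_j a_ij e_j. Power associativity is only used through the
   identity x^2 x^2 = (x^2 x) x, evaluated on combinations of at most three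
   basis vectors and of their squares. If a_ii != 0, it forces a_ki = 0 and
   a_ik e_k^2 = 0 for k != i, so that replacing e_i by the idempotent
   e_i^2 / a_ii^2 splits off a semisimple part. In the complement all a_ii
   vanish and a_ij a_jk e_k^2 = 0 = e_i^2 e_j^2. The nil part is then described
   by diagonal quadratic forms with values in the annihilator and, when some
   e_i^2 is outside the annihilator, by isotropic vectors for such a form, each
   of which spans a hyperbolic plane together with a second isotropic vector.

   Conversely the families are told apart by the dimensions of the iterated
   annihilators Ann_1, Ann_2, Ann_3, where Ann_(k+1) = {x | x E in Ann_k}, and
   by the number of lines <x^2> != 0 with x E contained in <x^2>. *)
From HB Require Import structures.
Require Import Defs.
From mathcomp Require Import all_boot all_order all_algebra.
From mathcomp Require Import ring zify.
Set Implicit Arguments.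
Unset Strict Implicit.
Unset Printing Implicit Defensive.
Import GRing.Theory.
Local Open Scope ring_scope.

(** Reduces an equation between vectors to scalar equations on coordinates, where [ring] and [field]
    apply; [vring] and [vfield] rest on it. *)
Lemma vbasis_coord_inj (F : fieldType) (E : vectType F) (x y : E) :
  (forall i, coord (vbasis {:E}) i x = coord (vbasis {:E}) i y) -> x = y.
Proof.
move=> eq_xy; rewrite (coord_vbasis (memvf x)) (coord_vbasis (memvf y)).
by apply: eq_bigr => i _; rewrite eq_xy.
Qed.

Ltac coords i :=
  apply: vbasis_coord_inj => i;
  rewrite ?(linearD, linearN, linearZ, linear0) /=.
Ltac vring := let i := fresh "i" in coords i; ring.
Ltac vfield := let i := fresh "i" in coords i; field.

Section Product.
Variables (F : fieldType) (E : vectType F) (mul : {bilinear E -> E -> E}).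
Implicit Types (x y z : E) (k : F).

Lemma amulDl x y z : mul (x + y) z = mul x z + mul y z.
Proof. exact: linearDl. Qed.
Lemma amulDr x y z : mul z (x + y) = mul z x + mul z y.
Proof. exact: linearDr. Qed.
Lemma amulNl x z : mul (- x) z = - mul x z.
Proof. exact: linearNl. Qed.
Lemma amulNr x z : mul z (- x) = - mul z x.
Proof. exact: linearNr. Qed.
Lemma amulZl k x z : mul (k *: x) z = k *: mul x z.
Proof. exact: linearZl_LR. Qed.
Lemma amulZr k x z : mul z (k *: x) = k *: mul z x.
Proof. exact: linearZr_LR. Qed.
Lemma amul0l z : mul 0 z = 0.
Proof. exact: linear0l. Qed.
Lemma amul0r z : mul z 0 = 0.
Proof. exact: linear0r. Qed.

Definition amulE := (amulDl, amulDr, amulNl, amulNr, amulZl, amulZr, amul0l, amul0r).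

Lemma power_associative_quartic : power_associative mul ->
  forall x, mul (mul x x) (mul x x) = mul (mul (mul x x) x) x.
Proof.
move=> pa x; symmetry; apply: (pa x) => // U subU xU.
exact: (subU x x xU xU).
Qed.

End Product.

Lemma notin_line_coef (F : fieldType) (E : vectType F) (u w : E) (k l : F) :
  u != 0 -> w \notin <[u]>%VS -> k *: u + l *: w = 0 -> k = 0 /\ l = 0.
Proof.
move=> u0 wu klE; have l0 : l = 0.
  apply: contraNeq wu => l0; apply/vlineP; exists (- (l^-1 * k)).
  rewrite scaleNr -scalerA; have -> : k *: u = - (l *: w).
    by apply/eqP; rewrite -subr_eq0 opprK klE.
  by rewrite scalerN opprK scalerA mulVf ?scale1r.
split=> //; move: klE; rewrite l0 scale0r addr0 => /eqP.
by rewrite scaler_eq0 (negbTE u0) orbF => /eqP.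
Qed.

(** * The quartic identity on two basis vectors *)

Section TwoBasisVectors.
Variables (F : fieldType) (E : vectType F) (mul : {bilinear E -> E -> E}).
Hypothesis two_neq0 : 2%:R != 0 :> F.
Hypothesis mulC : forall x y, mul x y = mul y x.
Hypothesis quartic :
  forall x, mul (mul x x) (mul x x) = mul (mul (mul x x) x) x.
(* For natural basis vectors p and q, (a, b) and (c, d) are the coordinates of
   u = p^2 and w = q^2 on (p, q). *)
Variables (p q u w : E) (a b c d : F).
Hypotheses (pp : mul p p = u) (qq : mul q q = w) (pq : mul p q = 0).
Hypotheses (pu : mul p u = a *: u) (qu : mul q u = b *: w).
Hypotheses (pw : mul p w = c *: u) (qw : mul q w = d *: w).

Let qp : mul q p = 0. Proof. by rewrite mulC. Qed.
Let up : mul u p = a *: u. Proof. by rewrite mulC. Qed.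
Let uq : mul u q = b *: w. Proof. by rewrite mulC. Qed.
Let wp : mul w p = c *: u. Proof. by rewrite mulC. Qed.
Let wq : mul w q = d *: w. Proof. by rewrite mulC. Qed.
Let products := (pp, qq, pq, qp, pu, qu, pw, qw, up, uq, wp, wq).

Lemma square_p : mul u u = a ^+ 2 *: u.
Proof. by have := quartic p; rewrite !(products, amulE) => ->; vring. Qed.

Lemma square_q : mul w w = d ^+ 2 *: w.
Proof. by have := quartic q; rewrite !(products, amulE) => ->; vring. Qed.

(** The quartic identity at p + t q, after [square_p] and [square_q] have removed the parts of
    degree 4 in p alone and in q alone. The scalar t stays free so that the parts even and odd in t
    can be separated. *)
Lemma quartic_line t : (t ^+ 2 * 2%:R) *: mul u w =
  (t ^+ 2 * (c * a) + t * (b + t ^+ 2 * d) * c) *: u +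
  (t * (a + t ^+ 2 * c) * b + t ^+ 2 * (b * d)) *: w.
Proof.
have := quartic (p + t *: q).
do !rewrite ?(products, amulE, scaler0, addr0, add0r).
rewrite (mulC w u) square_p square_q => /(congr1 (fun v =>
  v - a ^+ 2 *: u - (t ^+ 2 * t ^+ 2 * d ^+ 2) *: w)) eqt.
apply: etrans (etrans eqt _); vring.
Qed.

(** Adding the instances t = 1 and t = -1 of [quartic_line] cancels the part odd in t. *)
Lemma mul_squares : 2%:R *: mul u w = (c * a) *: u + (b * d) *: w.
Proof.
have D1 := quartic_line 1; have D2 := quartic_line (-1).
apply: (scalerI two_neq0).
have: (1 ^+ 2 * 2%:R) *: mul u w + ((-1) ^+ 2 * 2%:R) *: mul u w =
  2%:R *: ((c * a) *: u + (b * d) *: w) by rewrite D1 D2; vring.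
by move=> <-; vring.
Qed.

(** The odd part of [quartic_line], obtained by removing the even part with [mul_squares] and
    dividing by t. *)
Lemma quartic_odd t : t != 0 ->
  ((b + t ^+ 2 * d) * c) *: u + ((a + t ^+ 2 * c) * b) *: w = 0.
Proof.
move=> t0; apply: (scalerI t0); have D := quartic_line t.
have: (t ^+ 2) *: (2%:R *: mul u w) - (t ^+ 2 * 2%:R) *: mul u w = 0 by vring.
rewrite D mul_squares => /(congr1 -%R); rewrite oppr0 scaler0 => <-; vring.
Qed.

(** If c were nonzero, proportionality and [mul_squares] would give c = l a, d = l b and a^2 = l b^2
    with b nonzero. A vector x then exists with x^2 a nonzero multiple of u and x^2 x = 0, while u^2
    = a^2 u is nonzero, against the quartic identity. *)
Lemma quartic_proportional l :
  w = l *: u -> a != 0 -> u != 0 -> c = 0.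
Proof.
move=> wE a0 u0; apply/eqP; apply/negPn/negP => c0.
have scaleu k k' : k *: u = k' *: u -> k = k'.
  by move/eqP; rewrite -subr_eq0 -scalerBl scaler_eq0 (negbTE u0) orbF subr_eq0 => /eqP.
have cE : c = l * a.
  by apply: (scaleu); rewrite -pw wE amulE pu scalerA.
have l0 : l != 0 by apply: contraNneq c0 => l0; rewrite cE l0 mul0r.
have dE : d = l * b.
  apply: (mulIf l0); apply: (scaleu); rewrite -scalerA -wE -qw.
  by rewrite [in LHS]wE amulE qu wE !scalerA; congr (_ *: _); ring.
have uu := square_p.
have aE : a ^+ 2 = l * b ^+ 2.
  apply: (mulfI l0); apply: (scaleu).
  have := mul_squares; rewrite wE amulE uu cE dE !scalerA -scalerDl=> /scaleu e2.
  congr (_ *: _); have -> : l * a ^+ 2 = 2%:R * (l * a ^+ 2) - l * a * a by ring.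
  by rewrite e2; ring.
have b0 : b != 0.
  by apply: contraNneq a0 => b0; move/eqP: aE; rewrite b0 expr0n mulr0 sqrf_eq0.
have lE : l = a ^+ 2 / b ^+ 2 by rewrite aE mulfK ?sqrf_eq0.
(* With f := u / a^2 idempotent, x is the sum of the components of p and q in
   the kernel of the multiplication by f. *)
pose x := p + q - (a^-1 + b^-1) *: u.
have xx : mul x x = (- 2%:R * a / b) *: u.
  rewrite /x; do !rewrite ?(products, amulE, scaler0, addr0, add0r) ?uu.
  by rewrite wE lE; coords i; field; rewrite a0 b0.
have xxx : mul (mul x x) x = 0.
  rewrite xx /x; do !rewrite ?(products, amulE, scaler0, addr0, add0r) ?uu.
  by rewrite wE lE; coords i; field; rewrite a0 b0.
have := quartic x; rewrite xxx xx amul0l !amulE uu !scalerA => /eqP.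
rewrite scaler_eq0 (negbTE u0) orbF !mulf_eq0 invr_eq0 oppr_eq0.
by rewrite (negbTE two_neq0) (negbTE a0) (negbTE b0).
Qed.

(** When u and w are independent, both coefficients in [quartic_odd] vanish. If c were nonzero, t =
    1 would give d = -b, and also c = -a when b is nonzero; each case is refuted by a suitable
    combination x of u and w. *)
Lemma quartic_column : a != 0 -> u != 0 -> c = 0.
Proof.
move=> a0 u0; have [/vlineP [l wE]|wu] := boolP (w \in <[u]>%VS).
  exact: quartic_proportional wE a0 u0.
apply/eqP; apply/negPn/negP => c0.
have coef := notin_line_coef u0 wu.
have dE : d = - b.
  have [/eqP + _] := coef _ _ (quartic_odd (oner_neq0 _)).
  by rewrite mulf_eq0 (negbTE c0) orbF expr1n mul1r addrC addr_eq0 => /eqP.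
have uu := square_p; have ww := square_q; have uw := mul_squares.
have uwE : mul u w = (c * a / 2%:R) *: u + (b * d / 2%:R) *: w.
  apply: (scalerI two_neq0); rewrite uw; vfield; exact: two_neq0.
have [b0|b0] := eqVneq b 0.
  (* Now w^2 = 0, and x is such that x^2 is proportional to u while u x = 0. *)
  pose x := c *: u - (2%:R * a) *: w.
  have xx : mul x x = (- (a ^+ 2 * c ^+ 2)) *: u.
    rewrite /x !amulE (mulC w u) uwE uu ww dE b0.
    vfield; exact: two_neq0.
  have xxx : mul (mul x x) x = 0.
    rewrite xx /x !amulE uwE uu b0; vfield; exact: two_neq0.
  have := quartic x; rewrite xxx xx amul0l !amulE uu !scalerA => /eqP.
  rewrite scaler_eq0 (negbTE u0) orbF !(mulf_eq0, oppr_eq0).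
  by rewrite (negbTE a0) (negbTE c0).
have cE : c = - a.
  have [_ /eqP] := coef _ _ (quartic_odd (oner_neq0 _)).
  by rewrite mulf_eq0 (negbTE b0) orbF expr1n mul1r addrC addr_eq0 => /eqP.
(* As F may have three elements, the powers of t in [quartic_odd] cannot be
   separated, and the case a^2 = b^2 has to be excluded by another x. *)
have abE : a ^+ 2 = b ^+ 2.
  (* At t = a / b, with d = -b, the coefficient of u in [quartic_odd] is (b - a^2 / b) c. *)
  have ab0 : a / b != 0 by rewrite mulf_neq0 ?invr_eq0.
  have [/eqP + _] := coef _ _ (quartic_odd ab0).
  rewrite mulf_eq0 (negbTE c0) orbF dE => /eqP ab.
  apply/eqP; rewrite eq_sym -subr_eq0; apply/eqP; rewrite -[RHS](mulr0 b) -ab.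
  by field.
pose x := 2%:R *: u + w.
have uwE' : mul u w = - (a ^+ 2 / 2%:R) *: (u + w).
  rewrite uwE cE dE; coords i.
  rewrite (_ : b * - b = - a ^+ 2); last by rewrite abE; ring.
  by field; exact: two_neq0.
have ww' : mul w w = a ^+ 2 *: w by rewrite ww dE sqrrN abE.
have xx : mul x x = a ^+ 2 *: (2%:R *: u - w).
  rewrite /x !amulE (mulC w u) uwE' uu ww'; vfield; exact: two_neq0.
have := quartic x; rewrite xx /x.
rewrite !(amulE, mulC w u, uwE', uu, ww') => x4.
(* Up to the factor a^6, the two sides of the quartic identity are 6 u + 3 w and 7 u - 2 w. The
   coefficients of u differ by 1, which is nonzero in every characteristic. *)
have [|/eqP + _] := coef (a ^+ 6 * (6%:R - 7%:R)) (a ^+ 6 * (3%:R + 2%:R)).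
  move/eqP: x4; rewrite -subr_eq0 => /eqP x4; apply: etrans x4.
  vfield; exact: two_neq0.
by rewrite !mulf_eq0 (negbTE a0) /= -oppr_eq0 opprB -natrB ?oner_eq0.
Qed.

Lemma quartic_row : a != 0 -> u != 0 -> b *: w = 0.
Proof.
move=> a0 u0; apply: (scalerI a0); rewrite scaler0.
have := quartic_odd (oner_neq0 _); rewrite (quartic_column a0 u0) => <-; vring.
Qed.

Lemma nil_mul_squares : a = 0 -> d = 0 -> mul u w = 0.
Proof.
move=> a0 d0; apply: (scalerI two_neq0); rewrite mul_squares a0 d0; vring.
Qed.

(** Here [quartic_odd] reads b c (u + w) = 0. Multiplication by q kills w and sends u to b w, so b
    (b c w) = 0. *)
Lemma nil_antisymmetric : a = 0 -> d = 0 -> (b * c) *: w = 0.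
Proof.
move=> a0 d0; have odd1 := quartic_odd (oner_neq0 _).
have bcE : (b * c) *: w = - (b * c) *: u.
  apply/eqP; rewrite -subr_eq0 -odd1 a0 d0; apply/eqP; vring.
have [->|b0] := eqVneq b 0; first by rewrite mul0r scale0r.
apply: (scalerI b0); rewrite scaler0; apply: etrans (_ : mul q ((b * c) *: u) = _).
  by rewrite amulE qu !scalerA; congr (_ *: _); ring.
have -> : (b * c) *: u = - ((b * c) *: w) by rewrite bcE scaleNr opprK.
by rewrite !amulE qw d0 scale0r scaler0 oppr0.
Qed.

End TwoBasisVectors.

(** * The quartic identity on three basis vectors *)

Section ThreeBasisVectors.
Variables (F : fieldType) (E : vectType F) (mul : {bilinear E -> E -> E}).
Hypothesis two_neq0 : 2%:R != 0 :> F.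
Hypothesis mulC : forall x y, mul x y = mul y x.
Hypothesis quartic :
  forall x, mul (mul x x) (mul x x) = mul (mul (mul x x) x) x.
Variables (p q r u v w : E) (a_pq a_pr a_qp a_qr a_rp a_rq : F).
Hypotheses (pp : mul p p = u) (qq : mul q q = v) (rr : mul r r = w).
Hypotheses (pq : mul p q = 0) (pr : mul p r = 0) (qr : mul q r = 0).
Hypotheses (pu : mul p u = 0) (pv : mul p v = a_qp *: u)
  (pw : mul p w = a_rp *: u).
Hypotheses (qu : mul q u = a_pq *: v) (qv : mul q v = 0)
  (qw : mul q w = a_rq *: v).
Hypotheses (ru : mul r u = a_pr *: w) (rv : mul r v = a_qr *: w)
  (rw : mul r w = 0).

Let products := (pp, qq, rr, pq, pr, qr, pu, pv, pw, qu, qv, qw, ru, rv, rw).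

(** For signs k and l, the square of p + k q + l r is u + v + w whatever the signs. Only the right
    side of the quartic identity depends on them, so its part odd in both k and l must vanish. *)
Lemma quartic_three : (a_pq * a_qr + a_rq * a_qr) *: w +
  (a_pr * a_rq + a_qr * a_rq) *: v = 0.
Proof.
have m4 (k l : F) : k ^+ 2 = 1 -> l ^+ 2 = 1 ->
    mul (u + v + w) (u + v + w) =
    (a_qp + a_rp) *: (k *: (a_pq *: v) + l *: (a_pr *: w)) +
    (k * (a_pq + a_rq)) *: (a_qp *: u + l *: (a_qr *: w)) +
    (l * (a_pr + a_qr)) *: (a_rp *: u + k *: (a_rq *: v)).
  move=> kk ll; set m := u + v + w; pose x := p + k *: q + l *: r.
  have xx : mul x x = m.
    rewrite /x !(amulE, products, mulC q p, mulC r p, mulC r q).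
    by rewrite !(scaler0, addr0, add0r) !scalerA -!expr2 kk ll !scale1r.
  have xm : mul x m = (a_qp + a_rp) *: u + (k * (a_pq + a_rq)) *: v +
      (l * (a_pr + a_qr)) *: w.
    rewrite /x /m !(amulE, products); vring.
  rewrite -{1 2}xx quartic xx (mulC m) xm mulC /x.
  rewrite !(amulE, products); vring.
(* The alternating sum over the signs k and l isolates the terms odd in both. *)
have four_neq0 : 4%:R != 0 :> F by rewrite (natrM _ 2 2) mulf_neq0.
have sq1 := expr1n F 2; have sqN1 : (-1 : F) ^+ 2 = 1 by rewrite sqrrN expr1n.
set m := u + v + w in m4.
apply: (scalerI four_neq0); rewrite scaler0.
have: mul m m - mul m m - mul m m + mul m m = 0 by vring.
rewrite {1}(m4 _ _ sq1 sq1) {1}(m4 _ _ sq1 sqN1) {1}(m4 _ _ sqN1 sq1).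
rewrite {1}(m4 _ _ sqN1 sqN1) => <-; vring.
Qed.

End ThreeBasisVectors.

(** * Splitting off the idempotents *)

Section Adapted.
Variables (F : fieldType) (E : vectType F) (mul : {bilinear E -> E -> E}).

(* The nil part of the algebra is spanned by [t2 ++ t1 ++ zs], where [zs] spans
   its annihilator and the squares of [t1] are in the annihilator. *)
Record adapted (fs t2 t1 zs : seq E) : Prop := Adapted {
  adapted_basis : basis_of fullv (fs ++ t2 ++ t1 ++ zs);
  adapted_orth : {in fs ++ t2 ++ t1 ++ zs &, forall x y, x != y -> mul x y = 0};
  adapted_idem : {in fs, forall x, mul x x = x};
  adapted_t2_in : {in t2, forall x, mul x x \in <<t1 ++ zs>>%VS};
  adapted_t2_notin : {in t2, forall x, mul x x \notin <<zs>>%VS};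
  adapted_t2_mul : {in t2 &, forall x y, mul (mul x x) (mul y y) = 0};
  adapted_t1_in : {in t1, forall x, mul x x \in <<zs>>%VS};
  adapted_t1_neq0 : {in t1, forall x, mul x x != 0};
  adapted_zs : {in zs, forall x, mul x x = 0}
}.

Lemma mul_span0 x v (s : seq E) :
  {in s, forall z, mul x z = 0} -> v \in <<s>>%VS -> mul x v = 0.
Proof.
move=> s0 /(@coord_span _ _ _ (in_tuple s)) ->; rewrite linear_sumr big1 // => i _.
by rewrite linearZr_LR s0 ?scaler0 // mem_nth.
Qed.

End Adapted.

Section NaturalTuple.
Variables (F : fieldType) (E : vectType F) (mul : {bilinear E -> E -> E}).
Variables (n : nat) (X : n.-tuple E).
Hypothesis X_basis : basis_of fullv X.
Hypothesis X_orth : forall i j : 'I_n, i != j -> mul X`_i X`_j = 0.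

Notation sq i := (mul X`_i X`_i).
Notation a i j := (coord X j (sq i)).

Lemma mul_basisl (k : 'I_n) v : mul X`_k v = coord X k v *: sq k.
Proof.
rewrite {1}(coord_basis X_basis (memvf v)) linear_sumr (bigD1 k) //= amulZr.
by rewrite big1 ?addr0 // => j jk; rewrite amulZr X_orth 1?eq_sym // scaler0.
Qed.

Lemma mul_basisr (k : 'I_n) v : mul v X`_k = coord X k v *: sq k.
Proof.
rewrite {1}(coord_basis X_basis (memvf v)) linear_sumlz (bigD1 k) //= amulZl.
by rewrite big1 ?addr0 // => j jk; rewrite amulZl X_orth // scaler0.
Qed.

Lemma natural_mulC x y : mul x y = mul y x.
Proof.
rewrite (coord_basis X_basis (memvf x)) linear_sumr linear_sumlz.
by apply: eq_bigr => i _; rewrite amulZl amulZr (mul_basisl i) (mul_basisr i y).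
Qed.

Hypothesis two_neq0 : 2%:R != 0 :> F.
Hypothesis quartic :
  forall x, mul (mul x x) (mul x x) = mul (mul (mul x x) x) x.

Lemma natural_sq_neq0 i j : a i j != 0 -> sq i != 0.
Proof. by apply: contraNneq => ->; rewrite linear0. Qed.

(** Instance of the two-vector study with p = e_i, q = e_k, where e_i is the i-th vector of [X]; the
    scalars a, b, c, d there are the entries ii, ik, ki, kk of the structure matrix. *)
Lemma diag_column (i k : 'I_n) : a i i != 0 -> k != i -> a k i = 0.
Proof.
move=> aii; rewrite eq_sym => ik.
exact: (quartic_column two_neq0 natural_mulC quartic (erefl (sq i))
  (erefl (sq k)) (X_orth ik) (mul_basisl _ _) (mul_basisl _ _)
  (mul_basisl _ _) (mul_basisl _ _) aii (natural_sq_neq0 aii)).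
Qed.

Lemma diag_row (i k : 'I_n) : a i i != 0 -> k != i -> a i k *: sq k = 0.
Proof.
move=> aii; rewrite eq_sym => ik.
exact: (quartic_row two_neq0 natural_mulC quartic (erefl (sq i))
  (erefl (sq k)) (X_orth ik) (mul_basisl _ _) (mul_basisl _ _)
  (mul_basisl _ _) (mul_basisl _ _) aii (natural_sq_neq0 aii)).
Qed.

Lemma nil_mul_sq (i k : 'I_n) : a i i = 0 -> a k k = 0 -> mul (sq i) (sq k) = 0.
Proof.
move=> aii akk; have [<-|ik] := eqVneq i k.
  rewrite (square_p natural_mulC quartic (erefl (sq i)) (mul_basisl _ _)).
  by rewrite aii expr0n scale0r.
exact: (nil_mul_squares two_neq0 natural_mulC quartic (erefl (sq i))
  (erefl (sq k)) (X_orth ik) (mul_basisl _ _) (mul_basisl _ _)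
  (mul_basisl _ _) (mul_basisl _ _)).
Qed.

Lemma nil_chain2 (j k : 'I_n) : a j j = 0 -> a k k = 0 ->
  (a j k * a k j) *: sq k = 0.
Proof.
move=> ajj akk; have [<-|jk] := eqVneq j k; first by rewrite ajj mul0r scale0r.
exact: (nil_antisymmetric two_neq0 natural_mulC quartic (erefl (sq j))
  (erefl (sq k)) (X_orth jk) (mul_basisl _ _) (mul_basisl _ _)
  (mul_basisl _ _) (mul_basisl _ _)).
Qed.

(** For distinct indices, [quartic_three] contains the wanted term together with terms in a_jk a_kj
    e_k^2 and a_kj e_j^2. The first vanishes by [nil_chain2]; so does the second as soon as a_jk is
    nonzero. *)
Lemma nil_chain3 (i j k : 'I_n) : a i i = 0 -> a j j = 0 -> a k k = 0 ->
  (a i j * a j k) *: sq k = 0.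
Proof.
move=> aii ajj akk.
have [->|ij] := eqVneq i j; first by rewrite ajj mul0r scale0r.
have [->|jk] := eqVneq j k; first by rewrite akk mulr0 scale0r.
have [->|ik] := eqVneq i k; first by rewrite mulrC nil_chain2.
have mulX0 l : a l l = 0 -> mul X`_l (sq l) = 0.
  by move=> all0; rewrite mul_basisl all0 scale0r.
have q3 := quartic_three two_neq0 natural_mulC quartic (erefl (sq i))
  (erefl (sq j)) (erefl (sq k)) (X_orth ij) (X_orth ik) (X_orth jk)
  (mulX0 _ aii) (mul_basisl i _) (mul_basisl i _)
  (mul_basisl j _) (mulX0 _ ajj) (mul_basisl j _)
  (mul_basisl k _) (mul_basisl k _) (mulX0 _ akk).
have kj := nil_chain2 ajj akk; have jk0 := nil_chain2 akk ajj.
have [ajk|ajk] := eqVneq (a j k) 0; first by rewrite ajk mulr0 scale0r.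
have akj0 : a k j *: sq j = 0.
  by apply: (scalerI ajk); rewrite scalerA mulrC jk0 scaler0.
move: q3; rewrite !scalerDl [a k j * a j k]mulrC kj addr0 -!scalerA akj0.
by rewrite !scaler0 !addr0.
Qed.

Definition nil_index (i : 'I_n) := a i i == 0.

(** By [square_p] the square of e_i^2 is a_ii^2 e_i^2, so that e_i^2 / a_ii^2 is idempotent. *)
Let G : n.-tuple E :=
  [tuple if nil_index i then X`_i else (a i i) ^- 2 *: sq i | i < n].

Let GE (i : 'I_n) :
  G`_i = if nil_index i then X`_i else (a i i) ^- 2 *: sq i.
Proof. by rewrite -tnth_nth tnth_mktuple. Qed.

Let sq_nil i : ~~ nil_index i -> sq i =
  a i i *: X`_i + \sum_(j | nil_index j) a i j *: G`_j.
Proof.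
move=> ni; rewrite {1}(coord_basis X_basis (memvf (sq i))) (bigD1 i) //=.
congr (_ + _); rewrite [RHS]big_mkcond [LHS]big_mkcond; apply: eq_bigr => j _.
have [nj|nj] := boolP (nil_index j).
  by rewrite GE nj ifT //; apply: contraNneq ni => <-.
by case: eqP => //= /eqP ji; rewrite (diag_column nj) ?scale0r // eq_sym.
Qed.

(** By [sq_nil], each e_i with a_ii nonzero is recovered from its idempotent and the nil basis
    vectors, so [G] spans; it has the right number of elements. *)
Let G_basis : basis_of fullv G.
Proof.
rewrite basisEdim size_tuple (size_basis X_basis) leqnn andbT.
have GG (i : 'I_n) : G`_i \in <<G>>%VS.
  by rewrite memv_span // mem_nth ?size_tuple.
rewrite -(span_basis X_basis); apply/span_subvP => x /tnthP [i ->].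
rewrite (tnth_nth 0); have [ni|ni] := boolP (nil_index i).
  by have := GG i; rewrite GE ni.
have -> : X`_i = a i i *: G`_i - (a i i)^-1 *: \sum_(j | nil_index j) a i j *: G`_j.
  apply: (scalerI ni); apply/eqP; rewrite scalerBr !scalerA mulfV //.
  rewrite scale1r -subr_eq0 opprB addrA subr_eq0 -sq_nil //.
  by rewrite GE (negbTE ni) scalerA -expr2 mulfV ?scale1r // sqrf_eq0.
by rewrite memvB ?memvZ // memv_suml // => j _; rewrite memvZ.
Qed.

Let G_nil i : nil_index i -> G`_i = X`_i.
Proof. by rewrite GE => ->. Qed.

Let G_idem i : ~~ nil_index i -> mul G`_i G`_i = G`_i.
Proof.
move=> ni; rewrite GE (negbTE ni) !amulE.
rewrite (square_p natural_mulC quartic (erefl (sq i)) (mul_basisl _ _)).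
by rewrite !scalerA; congr (_ *: _); field.
Qed.

Let mul_sq_idem (i j : 'I_n) :
  ~~ nil_index i -> j != i -> mul (sq i) X`_j = 0.
Proof. by move=> ni ji; rewrite mul_basisr diag_row. Qed.

Let G_orth (i j : 'I_n) : i != j -> mul G`_i G`_j = 0.
Proof.
move=> ij; have ji : j != i by rewrite eq_sym.
have [ni|ni] := boolP (nil_index i); have [nj|nj] := boolP (nil_index j).
- by rewrite !G_nil // X_orth.
- by rewrite G_nil // GE (negbTE nj) amulZr natural_mulC mul_sq_idem ?scaler0.
- by rewrite (G_nil nj) GE (negbTE ni) amulZl mul_sq_idem ?scaler0.
rewrite !GE (negbTE ni) (negbTE nj) !amulE.
suff -> : mul (sq i) (sq j) = 0 by rewrite !scaler0.
(* In the expansion of e_j^2, the e_i term has coefficient zero by [diag_column], and e_i^2 kills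
   all the other basis vectors by [diag_row]. *)
rewrite [X in mul _ X](coord_basis X_basis (memvf (sq j))) linear_sumr.
apply: big1 => l _; rewrite amulZr; have [->|li] := eqVneq l i.
  by rewrite (diag_column ni) ?scale0r.
by rewrite mul_sq_idem ?scaler0.
Qed.

Let coef_nil (i j : 'I_n) : nil_index i -> ~~ nil_index j -> a i j = 0.
Proof. by move=> ni nj; apply: (diag_column nj); apply: contraNneq nj => <-. Qed.

Let sq_sum (i : 'I_n) : nil_index i -> sq i = \sum_(j | nil_index j) a i j *: X`_j.
Proof.
move=> ni; rewrite {1}(coord_basis X_basis (memvf (sq i))) [RHS]big_mkcond /=.
by apply: eq_bigr => j _; case: ifPn => // nj; rewrite coef_nil ?scale0r.
Qed.

Let chain (i j k : 'I_n) : nil_index i -> nil_index j -> (a i j * a j k) *: sq k = 0.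
Proof.
move=> ni nj; have [nk|nk] := boolP (nil_index k).
  by rewrite nil_chain3 //; apply/eqP.
by rewrite (coef_nil nj nk) mulr0 scale0r.
Qed.

(** Since e_i^2 e_j = a_ij e_j^2, this says that e_i^2 is outside the annihilator. *)
Let deep (i : 'I_n) := [exists j : 'I_n, (a i j != 0) && (sq j != 0)].

(** The indices of [G] are sorted into idempotents, deep nil indices, other nil indices with nonzero
    square, and nil indices with zero square. *)
Lemma adapted_basis_exists : exists fs t2 t1 zs, adapted mul fs t2 t1 zs.
Proof.
pose I := enum 'I_n; pose N := [seq i <- I | nil_index i].
pose fsI := [seq i <- I | ~~ nil_index i]; pose t2I := [seq i <- N | deep i].
pose N' := [seq i <- N | ~~ deep i].
pose t1I := [seq i : 'I_n <- N' | sq i != 0]; pose zsI := [seq i : 'I_n <- N' | sq i == 0].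
pose g := [fun i : 'I_n => G`_i].
have permI : perm_eq (fsI ++ t2I ++ t1I ++ zsI) I.
  have e1 : perm_eq (fsI ++ N) I by rewrite perm_catC perm_filterC.
  have e2 : perm_eq (t2I ++ N') N by rewrite perm_filterC.
  have e3 : perm_eq (t1I ++ zsI) N' by rewrite perm_catC perm_filterC.
  apply: perm_trans e1; rewrite perm_cat2l; apply: perm_trans e2.
  by rewrite perm_cat2l.
have GI : map g I = G.
  apply: (@eq_from_nth _ 0); rewrite size_map size_enum_ord ?size_tuple //.
  move=> i lt_in; rewrite (nth_map (Ordinal lt_in)) ?size_enum_ord //=.
  by rewrite nth_enum_ord.
have mem_I (i : 'I_n) : i \in I by rewrite mem_enum.
have mem_fs i : (i \in fsI) = ~~ nil_index i by rewrite mem_filter mem_I andbT.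
have mem_N i : (i \in N) = nil_index i by rewrite mem_filter mem_I andbT.
have mem_t2 i : (i \in t2I) = deep i && nil_index i by rewrite mem_filter mem_N.
have mem_N' i : (i \in N') = ~~ deep i && nil_index i.
  by rewrite mem_filter mem_N.
have mem_t1 (i : 'I_n) : (i \in t1I) = [&& sq i != 0, ~~ deep i & nil_index i].
  by rewrite mem_filter mem_N'.
have mem_zs (i : 'I_n) : (i \in zsI) = [&& sq i == 0, ~~ deep i & nil_index i].
  by rewrite mem_filter mem_N'.
have zs_ann (j : 'I_n) v : nil_index j -> v \in <<map g zsI>>%VS ->
    mul X`_j v = 0.
  move=> nj; apply: mul_span0 => z /mapP [l].
  rewrite mem_zs => /and3P [/eqP sql _ nl] -> /=.
  by rewrite G_nil // mul_basisr sql scaler0.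
exists (map g fsI), (map g t2I), (map g t1I), (map g zsI); split.
- by rewrite -!map_cat (perm_basis _ (perm_map g permI)) GI.
- move=> x y; rewrite -!map_cat !(perm_mem (perm_map g permI)).
  move=> /mapP [i _ ->] /mapP [j _ ->] ij; apply: G_orth.
  by apply: contraNneq ij => ->.
- by move=> x /mapP [i]; rewrite mem_fs => ni ->; apply: G_idem.
- move=> x /mapP [i]; rewrite mem_t2 => /andP [di ni] -> /=.
  rewrite G_nil // sq_sum //; apply: memv_suml => j nj.
  have [->|aij] := eqVneq (a i j) 0; first by rewrite scale0r mem0v.
  rewrite memvZ // -G_nil // memv_span //.
  (* By [chain], an index occurring in the square of a nil basis vector is never deep; hence the
     square of a deep vector avoids [t2]. *)
  have Ndeep : ~~ deep j.
    apply/existsP => -[k /andP [ajk sqk]]; have /eqP := chain k ni nj.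
    by rewrite scaler_eq0 (negbTE sqk) mulf_eq0 (negbTE aij) (negbTE ajk).
  rewrite -map_cat (map_f g) // mem_cat mem_t1 mem_zs Ndeep nj.
  by case: (sq j == 0).
- move=> x /mapP [i]; rewrite mem_t2 => /andP [/existsP [j] + ni] -> /=.
  rewrite G_nil // => /andP [aij sqj]; apply/negP => /zs_ann.
  have nj : nil_index j by apply: contraNT aij => /(coef_nil ni) ->.
  by move=> /(_ _ nj) /eqP; rewrite mul_basisl scaler_eq0 (negbTE aij) (negbTE sqj).
- move=> x y /mapP [i]; rewrite mem_t2 => /andP [_ ni] -> /mapP [j].
  rewrite mem_t2 => /andP [_ nj] -> /=; rewrite !G_nil //.
  by apply: nil_mul_sq; apply/eqP.
- move=> x /mapP [i]; rewrite mem_t1 => /and3P [_ di ni] -> /=.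
  rewrite G_nil // sq_sum //; apply: memv_suml => j nj.
  have [->|aij] := eqVneq (a i j) 0; first by rewrite scale0r mem0v.
  rewrite memvZ // -G_nil // memv_span // (map_f g) // mem_zs nj.
  (* As i is not deep, its square only involves basis vectors of zero square. *)
  have sqj : sq j == 0.
    by apply: contraNT di => sqj; apply/existsP; exists j; rewrite aij.
  rewrite sqj andbT /=; apply/existsP => -[k /andP [ajk _]].
  by rewrite (eqP sqj) linear0 eqxx in ajk.
- by move=> x /mapP [i]; rewrite mem_t1 => /and3P [sqi di ni] -> /=; rewrite G_nil.
- move=> x /mapP [i]; rewrite mem_zs => /and3P [/eqP sqi di ni] -> /=.
  by rewrite G_nil.
Qed.

End NaturalTuple.

(** * Changes of adapted basis *)

Section AdaptedTheory.
Variables (F : fieldType) (E : vectType F) (mul : {bilinear E -> E -> E}).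
Hypothesis mulC : forall x y, mul x y = mul y x.
Implicit Types (fs zs us ws : seq E).
Notation sq x := (mul x x).

Lemma basis_of_eq_span (l g : seq E) :
  basis_of fullv l -> size g = size l -> <<g>>%VS = <<l>>%VS -> basis_of fullv g.
Proof.
move=> l_basis gl g_l; rewrite basisEdim g_l (span_basis l_basis) subvv gl.
by rewrite (size_basis (X := in_tuple l) l_basis) leqnn.
Qed.

Lemma mul_span2 (s t : seq E) (U : {vspace E}) :
  {in s & t, forall x y, mul x y \in U} ->
  {in <<s>>%VS & <<t>>%VS, forall x y, mul x y \in U}.
Proof.
move=> stU x y /(@coord_span _ _ _ (in_tuple s)) ->.
move=> /(@coord_span _ _ _ (in_tuple t)) ->.
rewrite linear_sumlz; apply: memv_suml => i _.
rewrite linear_sumr; apply: memv_suml => j _.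
by rewrite amulZl amulZr !memvZ // stU ?mem_nth.
Qed.

Lemma adapted_ann fs t2 t1 zs x y :
  adapted mul fs t2 t1 zs -> y \in <<zs>>%VS -> mul x y = 0.
Proof.
move=> ad yz; have := memvf x; rewrite -(span_basis (adapted_basis ad)) => xl.
apply/eqP; rewrite -memv0; apply: mul_span2 xl yz => {x y} x y xl yz.
have yl : y \in fs ++ t2 ++ t1 ++ zs by rewrite !mem_cat yz !orbT.
rewrite memv0; have [->|xy] := eqVneq x y; first by rewrite (adapted_zs ad).
by rewrite (adapted_orth ad).
Qed.

(** All products with the span of [zs] vanish, so any other basis of that span keeps
    orthogonality. *)
Lemma adapted_zs_change fs t2 t1 zs us :
  adapted mul fs t2 t1 zs -> <<us>>%VS = <<zs>>%VS -> size us = size zs ->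
  adapted mul fs t2 t1 us.
Proof.
move=> ad uz su.
have ann x y : y \in us -> mul x y = 0.
  by move=> yu; rewrite (adapted_ann _ ad) // -uz memv_span.
split; rewrite ?uz; try by case: ad.
- apply: (basis_of_eq_span (adapted_basis ad)); first by rewrite !size_cat su.
  by rewrite !span_cat uz.
- move=> x y xl yl xy; have [yu|yu] := boolP (y \in us); first exact: ann.
  have [xu|xu] := boolP (x \in us); first by rewrite mulC ann.
  apply: (adapted_orth ad) xy.
    by move: xl; rewrite !mem_cat (negbTE xu) orbF => /or3P [] ->; rewrite ?orbT.
  by move: yl; rewrite !mem_cat (negbTE yu) orbF => /or3P [] ->; rewrite ?orbT.
- by move=> x; rewrite !span_cat uz -span_cat; apply: (adapted_t2_in ad).
- by move=> x; apply: ann.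
Qed.

(** Serves to make the squares of vectors of [t1] themselves members of the basis; [ws] is a basis
    of a complement. *)
Lemma adapted_zs_extend fs t2 t1 zs us :
  adapted mul fs t2 t1 zs -> free us -> {subset us <= <<zs>>%VS} ->
  exists2 ws, (size us + size ws = size zs)%N & adapted mul fs t2 t1 (us ++ ws).
Proof.
move=> ad us_free us_zs; have zs_free : free zs.
  by have := basis_free (adapted_basis ad); do 3!move/catr_free.
have us_le : (<<us>> <= <<zs>>)%VS by apply/span_subvP.
have spanE : (<<us>> + (<<zs>> :\: <<us>>) = <<zs>>)%VS.
  by rewrite addvC addv_diff; apply/addv_idPl.
have dimE : (size us + \dim (<<zs>> :\: <<us>>) = size zs)%N.
  rewrite -(eqP us_free) -(eqP zs_free) -{2}spanE dimv_disjoint_sum //.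
  by rewrite capvC capv_diff.
exists (vbasis (<<zs>> :\: <<us>>)); first by rewrite size_tuple.
apply: (adapted_zs_change ad); last by rewrite size_cat size_tuple.
by rewrite span_cat (span_basis (vbasisP _)).
Qed.

(** The new vectors may have components along [zs]. Lying in the span of [t1 ++ zs], they remain
    orthogonal to [fs] and [t2], and their squares remain in the span of [zs] by bilinearity. *)
Lemma adapted_t1_change fs t2 t1 t1' zs :
  adapted mul fs t2 t1 zs -> <<t1' ++ zs>>%VS = <<t1 ++ zs>>%VS ->
  size t1' = size t1 -> {in t1' &, forall x y, x != y -> mul x y = 0} ->
  {in t1', forall x, sq x != 0} -> adapted mul fs t2 t1' zs.
Proof.
move=> ad spanE sizeE orth neq0.
have mem_t1' x : x \in t1' -> x \in <<t1 ++ zs>>%VS.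
  by move=> xt; rewrite -spanE memv_span // mem_cat xt.
have front_orth x y : x \in fs ++ t2 -> y \in t1' -> mul x y = 0.
  move=> xf yt; apply: mul_span0 (mem_t1' _ yt) => z ztz.
  apply: (adapted_orth ad); rewrite ?catA -?catA ?mem_cat.
  - by move: xf; rewrite mem_cat => /orP [] ->; rewrite ?orbT.
  - by move: ztz; rewrite mem_cat => /orP [] ->; rewrite ?orbT.
  have := free_uniq (basis_free (adapted_basis ad)); rewrite catA cat_uniq.
  case/and3P=> _ /hasPn /(_ _ ztz) /= + _; apply: contraNneq => <-.
  exact: xf.
split; try by case: ad.
- apply: (basis_of_eq_span (adapted_basis ad)).
    by rewrite !size_cat sizeE.
  by rewrite !span_cat -span_cat spanE span_cat.
- move=> x y xl yl xy.
  have [yz|yz] := boolP (y \in zs); first by rewrite (adapted_ann _ ad) ?memv_span.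
  have [xz|xz] := boolP (x \in zs).
    by rewrite mulC (adapted_ann _ ad) ?memv_span.
  move: xl yl; rewrite !catA !(mem_cat _ _ zs) (negbTE xz) (negbTE yz) !orbF.
  rewrite ![_ \in _ ++ t1']mem_cat => /orP [xf|xt] /orP [yf|yt].
  + apply: (adapted_orth ad) xy.
      by rewrite catA mem_cat xf.
    by rewrite catA mem_cat yf.
  + exact: front_orth.
  + by rewrite mulC front_orth.
  + exact: orth.
- by rewrite spanE; case: ad.
- move=> x xt; apply: mul_span2 (mem_t1' _ xt) (mem_t1' _ xt) => {xt} {}x y xt yt.
  have [yz|yz] := boolP (y \in zs).
    by rewrite (adapted_ann _ ad) ?mem0v ?memv_span.
  have [xz|xz] := boolP (x \in zs).
    by rewrite mulC (adapted_ann _ ad) ?mem0v ?memv_span.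
  have [<-|xy] := eqVneq x y.
    by apply: (adapted_t1_in ad); rewrite mem_cat (negbTE xz) orbF in xt.
  rewrite (adapted_orth ad) ?mem0v // !mem_cat.
    by move: xt; rewrite mem_cat => ->; rewrite !orbT.
  by move: yt; rewrite mem_cat => ->; rewrite !orbT.
Qed.

Lemma adapted_t1_perm fs t2 t1 t1' zs :
  perm_eq t1 t1' -> adapted mul fs t2 t1 zs -> adapted mul fs t2 t1' zs.
Proof.
move=> p ad; apply: (adapted_t1_change ad).
- by apply: eq_span => x; rewrite !mem_cat (perm_mem p).
- by rewrite (perm_size p).
- move=> x y; rewrite -!(perm_mem p) => xt yt; apply: (adapted_orth ad);
    by rewrite !mem_cat ?xt ?yt !orbT.
- by move=> x; rewrite -(perm_mem p); apply: (adapted_t1_neq0 ad).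
Qed.

Lemma line_dichotomy (x y : E) : x != 0 -> y != 0 ->
  (exists2 k, k != 0 & y = k *: x) \/ free [:: x; y].
Proof.
move=> x0 y0; have [/vlineP [k yE]|yx] := boolP (y \in <[x]>%VS).
  by left; exists k => //; apply: contraNneq y0 => k0; rewrite yE k0 scale0r.
right; rewrite (perm_free (_ : perm_eq _ [:: y; x])) ?(perm_catC [:: x] [:: y]) //.
by rewrite free_cons seq1_free x0 andbT span_seq1.
Qed.

Lemma mem_span_cons (x v : E) (s : seq E) :
  v \in <<x :: s>>%VS -> exists k, exists2 w, w \in <<s>>%VS & v = k *: x + w.
Proof.
by rewrite span_cons => /memv_addP [_ /vlineP [k ->] [w ws ->]]; exists k, w.
Qed.

Lemma mem_span1P (x v : E) : v \in <<[:: x]>>%VS -> exists k, v = k *: x.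
Proof. by rewrite span_seq1 => /vlineP. Qed.

End AdaptedTheory.

(** * Classification *)

Section Coordinates.
Variables (F : fieldType) (E : vectType F) (n : nat) (g : n.-tuple E).

Definition comb (v : 'rV[F]_n) : E := \sum_(j < n) v 0 j *: g`_j.

Lemma comb_linear : linear comb.
Proof.
move=> k u v; rewrite /comb scaler_sumr -big_split; apply: eq_bigr => j _ /=.
by rewrite !mxE scalerDl scalerA.
Qed.

HB.instance Definition _ := GRing.isLinear.Build F 'rV[F]_n E *:%R comb comb_linear.

Definition coords_row (x : E) : 'rV[F]_n := \row_j coord g j x.

Lemma coords_row_linear : linear coords_row.
Proof. by move=> k u v; apply/rowP => j; rewrite !mxE linearP. Qed.

HB.instance Definition _ :=
  GRing.isLinear.Build F E 'rV[F]_n *:%R coords_row coords_row_linear.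

Hypothesis g_basis : basis_of fullv g.

Lemma coords_rowK : cancel coords_row comb.
Proof.
move=> x; rewrite [RHS](coord_basis g_basis (memvf x)).
by apply: eq_bigr => j _; rewrite mxE.
Qed.

Lemma combK : cancel comb coords_row.
Proof.
move=> v; apply/rowP => j; rewrite mxE.
by rewrite (coord_sum_free _ _ (basis_free g_basis)).
Qed.

Lemma alg_isomorphic_evol (mul : {bilinear E -> E -> E}) (s : seq 'rV[F]_n) :
  (forall i j : 'I_n, i != j -> mul g`_i g`_j = 0) ->
  (forall i : 'I_n, mul g`_i g`_i = comb s`_i) ->
  alg_isomorphic mul (evol_mul s).
Proof.
move=> orth squares; exists (linfun coords_row); split.
  by exists comb => x; rewrite lfunE /= ?coords_rowK ?combK.
move=> x y; rewrite !lfunE /=; apply: (can_inj combK); rewrite coords_rowK.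
rewrite [in LHS](coord_basis g_basis (memvf x)) linear_sumlz linear_sum.
apply: eq_bigr => i _; rewrite amulZl (mul_basisl g_basis orth) squares !mxE.
by rewrite scalerA linearZ mulrC.
Qed.

End Coordinates.

Lemma comb_e (F : fieldType) (E : vectType F) (g : 5.-tuple E) (i : 'I_5) :
  comb g (e F i.+1) = g`_i.
Proof.
rewrite /comb (bigD1 i) //= mxE eqxx scale1r big1 ?addr0 // => j ji.
by rewrite mxE eqSS (negbTE (ji : j != i :> nat)) scale0r.
Qed.

Definition classified (F : fieldType) (E : vectType F)
    (mul : {bilinear E -> E -> E}) : Prop :=
  exists k, exists s, listed k s /\ alg_isomorphic mul (evol_mul s : 'rV[F]_5 -> _).

(** Reduces each case of the classification to a reordering of an adapted basis and five equations
    on squares. *)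
Lemma adapted_classified (F : fieldType) (E : vectType F)
    (mul : {bilinear E -> E -> E}) fs t2 t1 zs (g1 g2 g3 g4 g5 : E) k s :
  let g := [tuple g1; g2; g3; g4; g5] in
  listed k s -> adapted mul fs t2 t1 zs -> perm_eq (fs ++ t2 ++ t1 ++ zs) g ->
  [/\ mul g1 g1 = comb g s`_0, mul g2 g2 = comb g s`_1, mul g3 g3 = comb g s`_2,
      mul g4 g4 = comb g s`_3 & mul g5 g5 = comb g s`_4] ->
  classified mul.
Proof.
move=> g ks ad perm_g [sq1 sq2 sq3 sq4 sq5]; exists k, s; split=> //.
have g_basis : basis_of fullv g by rewrite -(perm_basis _ perm_g); case: ad.
apply: (alg_isomorphic_evol g_basis) => [i j ij|].
  apply: (adapted_orth ad); rewrite ?(perm_mem perm_g) ?mem_nth ?size_tuple //.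
  by rewrite nth_uniq ?size_tuple ?(free_uniq (basis_free g_basis)).
by case=> -[|[|[|[|[|i]]]]].
Qed.

Lemma comb_e5 (F : fieldType) (E : vectType F) (g1 g2 g3 g4 g5 : E) :
  let g := [tuple g1; g2; g3; g4; g5] in
  (comb g (e F 1) = g1) * (comb g (e F 2) = g2) * (comb g (e F 3) = g3) *
  (comb g (e F 4) = g4) * (comb g (e F 5) = g5).
Proof.
move=> g; have combE k (lt_k5 : (k < 5)%N) : comb g (e F k.+1) = g`_k.
  exact: (comb_e g (Ordinal lt_k5)).
by do !split; apply: (etrans (combE _ _)).
Qed.

Section Classification.
Variables (F : fieldType) (E : vectType F) (mul : {bilinear E -> E -> E}).
Hypothesis mulC : forall x y, mul x y = mul y x.
Hypothesis dimE : \dim {:E} = 5%N.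
Notation sq x := (mul x x).

Lemma adapted_size fs t2 t1 zs : adapted mul fs t2 t1 zs ->
  (size fs + (size t2 + (size t1 + size zs)) = 5)%N.
Proof.
move=> ad; rewrite -dimE (size_basis (X := in_tuple _) (adapted_basis ad)).
by rewrite !size_cat.
Qed.

Lemma adapted_free_zs fs t2 t1 zs : adapted mul fs t2 t1 zs -> free zs.
Proof. by move=> ad; have := basis_free (adapted_basis ad); do 3!move/catr_free. Qed.

Lemma adapted_sq1 fs t2 t1 zs x : adapted mul fs t2 t1 zs -> x \in t1 ->
  exists2 ws, (size ws).+1 = size zs & adapted mul fs t2 t1 (sq x :: ws).
Proof.
move=> ad xt; apply: (adapted_zs_extend mulC ad (us := [:: sq x])).
  by rewrite seq1_free (adapted_t1_neq0 ad).
by move=> y; rewrite inE => /eqP ->; apply: (adapted_t1_in ad).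
Qed.

Lemma adapted_sq2 fs t2 t1 zs x y : adapted mul fs t2 t1 zs ->
  x \in t1 -> y \in t1 ->
  (exists2 k, k != 0 & sq y = k *: sq x) \/
  exists2 ws, (size ws).+2 = size zs & adapted mul fs t2 t1 [:: sq x, sq y & ws].
Proof.
move=> ad xt yt; have nz := adapted_t1_neq0 ad.
have [|xy_free] := line_dichotomy (nz _ xt) (nz _ yt); first by left.
right; apply: (adapted_zs_extend mulC ad xy_free) => z.
by rewrite !inE => /orP [] /eqP ->; apply: (adapted_t1_in ad).
Qed.

Lemma adapted_sq_line fs t2 t1 z x : adapted mul fs t2 t1 [:: z] ->
  x \in t1 -> exists2 k, k != 0 & sq x = k *: z.
Proof.
move=> ad xt; have [k xk] := mem_span1P (adapted_t1_in ad xt).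
exists k => //; apply: contraNneq (adapted_t1_neq0 ad xt) => k0.
by rewrite xk k0 scale0r.
Qed.

(** Closes a case: [g1] to [g5] order the basis as in the family [rule], the reordering is checked
    by counting with [lia], and the squares not settled by computation are those of annihilator
    elements or of idempotents. An equation left open must already hold by a hypothesis that [done]
    finds. *)
Ltac leaf ad rule g1 g2 g3 g4 g5 :=
  apply: (@adapted_classified _ _ _ _ _ _ _ g1 g2 g3 g4 g5 _ _ rule ad);
  [ by apply/permP => P /=; lia
  | split;
    rewrite /= ?(linearD, linearN, linearZ, linear0) /= ?(comb_e5 g1 g2 g3 g4 g5);
    first [ done
          | by apply: (adapted_zs ad); rewrite !inE eqxx ?orbT
          | by apply: (adapted_idem ad); rewrite !inE eqxx ?orbT ] ].

(** * Algebras whose nil part has all its squares in the annihilator *)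

Lemma classified_t1_0 fs zs : adapted mul fs [::] [::] zs -> classified mul.
Proof.
move=> ad; have := adapted_size ad.
case: fs ad => [|f1 [|f2 [|f3 [|f4 [|f5 [|f6 fs]]]]]] ad /= size5; try lia.
- case: zs ad size5 => [|w1 [|w2 [|w3 [|w4 [|w5 [|w6 zs]]]]]] //= ad _.
  leaf ad (N1 F) w1 w2 w3 w4 w5.
- case: zs ad size5 => [|w1 [|w2 [|w3 [|w4 [|w5 zs]]]]] //= ad _.
  leaf ad (E13 F) f1 w1 w2 w3 w4.
- case: zs ad size5 => [|w1 [|w2 [|w3 [|w4 zs]]]] //= ad _.
  leaf ad (E19 F) f1 f2 w1 w2 w3.
- case: zs ad size5 => [|w1 [|w2 [|w3 zs]]] //= ad _.
  leaf ad (E22 F) f1 f2 f3 w1 w2.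
- case: zs ad size5 => [|w1 [|w2 zs]] //= ad _.
  leaf ad (E24 F) f1 f2 f3 f4 w1.
- case: zs ad size5 => [|w1 zs] //= ad _.
  leaf ad (E25 F) f1 f2 f3 f4 f5.
Qed.

Lemma classified_t1_1 fs x zs :
  adapted mul fs [::] [:: x] zs -> classified mul.
Proof.
move=> /adapted_sq1 /(_ (mem_head _ _)) [ws _ ad]; have := adapted_size ad.
case: fs ad => [|f1 [|f2 [|f3 [|f4 fs]]]] ad /= size5; try lia.
- case: ws ad size5 => [|w1 [|w2 [|w3 [|w4 ws]]]] //= ad _.
  leaf ad (N2 F) x (sq x) w1 w2 w3.
- case: ws ad size5 => [|w1 [|w2 [|w3 ws]]] //= ad _.
  leaf ad (E14 F) f1 x (sq x) w1 w2.
- case: ws ad size5 => [|w1 [|w2 ws]] //= ad _.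
  leaf ad (E20 F) f1 f2 x (sq x) w1.
- case: ws ad size5 => [|w1 ws] //= ad _.
  leaf ad (E23 F) f1 f2 f3 x (sq x).
Qed.

Lemma classified_t1_2 fs x y zs :
  adapted mul fs [::] [:: x; y] zs -> classified mul.
Proof.
have [xt yt] : x \in [:: x; y] /\ y \in [:: x; y] by rewrite !inE !eqxx orbT.
move=> ad; have [[k k0 yE]|[ws _ {}ad]] := adapted_sq2 ad xt yt.
  have [ws _ {}ad] := adapted_sq1 ad xt; have := adapted_size ad.
  case: fs ad => [|f1 [|f2 [|f3 fs]]] ad /= size5; try lia.
  - case: ws ad size5 => [|w1 [|w2 [|w3 ws]]] //= ad _.
    leaf ad (N3 k0) x y (sq x) w1 w2.
  - case: ws ad size5 => [|w1 [|w2 ws]] //= ad _.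
    leaf ad (E15 k0) f1 x y (sq x) w1.
  - case: ws ad size5 => [|w1 ws] //= ad _.
    leaf ad (E21 k0) f1 f2 x y (sq x).
have := adapted_size ad.
case: fs ad => [|f1 [|f2 fs]] ad /= size5; try lia.
- case: ws ad size5 => [|w1 [|w2 ws]] //= ad _.
  leaf ad (N4 F) x (sq x) y (sq y) w1.
- case: ws ad size5 => [|w1 ws] //= ad _.
  leaf ad (E16 F) f1 x (sq x) y (sq y).
Qed.

(** In dimension 5 the annihilator has dimension at most 2. Either the three squares lie on one
    line, or exactly two of them are proportional, or they are pairwise independent in a plane,
    which gives family 9. *)
Lemma classified_t1_3 fs x y z zs :
  adapted mul fs [::] [:: x; y; z] zs -> classified mul.
Proof.
set t1 := [:: x; y; z].
have [xt [yt zt]] : x \in t1 /\ y \in t1 /\ z \in t1.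
  by rewrite !inE !eqxx !orbT.
have one_line k l ws : k != 0 -> l != 0 -> sq y = k *: sq x -> sq z = l *: sq x ->
    adapted mul fs [::] t1 (sq x :: ws) -> classified mul.
  move=> k0 l0 yE zE ad; have := adapted_size ad.
  case: fs ad => [|f1 [|f2 fs]] ad /= size5; try lia.
  - case: ws ad size5 => [|w1 [|w2 ws]] //= ad _.
    leaf ad (N5 k0 l0) x y z (sq x) w1.
  - case: ws ad size5 => [|w1 ws] //= ad _.
    leaf ad (E17 k0 l0) f1 x y z (sq x).
have two_lines (a b c : E) k ws : perm_eq t1 [:: a; b; c] -> k != 0 ->
    sq b = k *: sq a -> adapted mul fs [::] t1 [:: sq a, sq c & ws] ->
    classified mul.
  move=> p k0 bE /(adapted_t1_perm mulC p) ad; have := adapted_size ad.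
  case: fs ws {one_line p} ad => [|f1 fs] [|w1 ws] ad //= size5; try lia.
  leaf ad (N6 k0) a b (sq a) c (sq c).
move=> ad; have [[k k0 yE]|[ws _ {}ad]] := adapted_sq2 ad xt yt.
  have [[l l0 zE]|[ws _ {}ad]] := adapted_sq2 ad xt zt.
    by have [ws _ {}ad] := adapted_sq1 ad xt; exact: one_line k0 l0 yE zE ad.
  exact: two_lines (perm_refl _) k0 yE ad.
have := adapted_size ad.
case: fs ws ad {one_line} two_lines => [|f1 fs] [|w1 ws] //= ad two_lines size5;
  try lia.
(* The annihilator is now exactly the plane of x^2 and y^2, and z^2 = k x^2 + l y^2; a vanishing k
   or l means two proportional squares. *)
have [k [v /mem_span1P [l ->] zE]] := mem_span_cons (adapted_t1_in ad zt).
have [k0|k0] := eqVneq k 0.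
  have l0 : l != 0.
    apply: contraNneq (adapted_t1_neq0 ad zt) => l0.
    by rewrite zE k0 l0 !scale0r addr0.
  apply: (two_lines y z x l [::]) => //.
  - by apply/permP => P /=; lia.
  - by rewrite zE k0 scale0r add0r.
  by apply: (adapted_zs_change mulC ad) => //; apply: eq_span => v'; rewrite !inE orbC.
have [l0|l0] := eqVneq l 0.
  apply: (two_lines x z y k [::]) => //.
  - by apply/permP => P /=; lia.
  by rewrite zE l0 scale0r addr0.
leaf ad (N9 k0 l0) x z y (sq x) (sq y).
Qed.

Lemma classified_t1_4 fs x y z t zs :
  adapted mul fs [::] [:: x; y; z; t] zs -> classified mul.
Proof.
move=> /adapted_sq1 /(_ (mem_head _ _)) [ws _ ad]; have := adapted_size ad.
case: fs ws ad => [|f1 fs] [|w1 ws] ad //= size5; try lia.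
have line b : b \in [:: x; y; z; t] -> exists2 k, k != 0 & sq b = k *: sq x.
  exact: adapted_sq_line ad.
have [|k k0 yE] := line y; first by rewrite !inE eqxx !orbT.
have [|l l0 zE] := line z; first by rewrite !inE eqxx !orbT.
have [|m m0 tE] := line t; first by rewrite !inE eqxx !orbT.
leaf ad (N8 k0 l0 m0) x y z t (sq x).
Qed.

(** * Algebras with a square outside the annihilator *)

Lemma adapted_t1_pairwise fs t2 t1 zs : adapted mul fs t2 t1 zs ->
  pairwise (fun x y => mul x y == 0) t1.
Proof.
move=> ad; have := free_uniq (basis_free (adapted_basis ad)).
rewrite !cat_uniq => /and3P [_ _ /and3P [_ _ /and3P [t1_uniq _ _]]].
move: t1_uniq; rewrite uniq_pairwise; apply: (sub_in_pairwise (P := mem t1)).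
  move=> x y xt yt xy; apply/eqP; apply: (adapted_orth ad) xy;
    by rewrite !mem_cat ?(xt : x \in t1) ?(yt : y \in t1) !orbT.
exact/allP.
Qed.

(** Write x^2 = b y1 + c y2 + z with z in the annihilator. As x^2 squares to zero, b^2 y1^2 = - c^2
    y2^2; as it is outside the annihilator, b and c are both nonzero. *)
Lemma adapted_pair fs t2 x y1 y2 zs :
  adapted mul fs (x :: t2) [:: y1; y2] zs -> exists g2 g3,
  [/\ adapted mul fs (x :: t2) [:: g2; g3] zs, sq x = g2 + g3 & sq g3 = - sq g2].
Proof.
move=> ad; have xt : x \in x :: t2 := mem_head _ _.
have /and3P [/andP [/eqP y12 _] _ _] := adapted_t1_pairwise ad.
have [b [r r_in xE]] := mem_span_cons (adapted_t2_in ad xt).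
have [c [z zzs rE]] := mem_span_cons r_in.
have z_ann v : mul v z = 0 := adapted_ann v ad zzs.
have ann_z v : mul z v = 0 by rewrite mulC.
have y1_neq0 : sq y1 != 0 by rewrite (adapted_t1_neq0 ad) ?inE ?eqxx.
have y2_neq0 : sq y2 != 0 by rewrite (adapted_t1_neq0 ad) ?inE ?eqxx ?orbT.
have sq_r : sq r = c ^+ 2 *: sq y2.
  by rewrite rE !amulE !(z_ann, ann_z, scaler0, addr0) scalerA.
have y1r : mul y1 r = 0 by rewrite rE !amulE z_ann y12 scaler0 addr0.
have isotropic : b ^+ 2 *: sq y1 + c ^+ 2 *: sq y2 = 0.
  have := adapted_t2_mul ad xt xt; rewrite xE !amulE (mulC r) y1r sq_r => <-.
  by rewrite scaler0 addr0 add0r scalerA.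
have coef0 : (b == 0) = (c == 0).
  apply/eqP/eqP => [b0|c0]; move/eqP: isotropic.
    by rewrite b0 expr0n scale0r add0r scaler_eq0 (negbTE y2_neq0) orbF sqrf_eq0 => /eqP.
  by rewrite c0 expr0n scale0r addr0 scaler_eq0 (negbTE y1_neq0) orbF sqrf_eq0 => /eqP.
have b0 : b != 0.
  apply: contraNneq (adapted_t2_notin ad xt) => b0.
  have /eqP c0 : c == 0 by rewrite -coef0 b0.
  by rewrite xE rE b0 c0 !scale0r !add0r.
have c0 : c != 0 by rewrite -coef0.
have sq_by : sq (b *: y1) = b ^+ 2 *: sq y1 by rewrite !amulE scalerA.
(* The second vector r = c y2 + z absorbs the annihilator component, so that the sum is exactly
   x^2. *)
exists (b *: y1), r; split=> //.
  apply: (adapted_t1_change mulC ad) => //.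
  - apply/eqP; rewrite eqEsubv; apply/andP; split; apply/span_subvP => v /=;
      rewrite !inE => /or3P [/eqP ->|/eqP ->|vz].
    + by rewrite memvZ // memv_span // mem_head.
    + by rewrite span_cons -[r]add0r memv_add ?mem0v.
    + by rewrite memv_span // !inE vz !orbT.
    + rewrite -{1}(scalerK b0 y1) memvZ // memv_span ?mem_head //.
    + rewrite -(scalerK c0 y2) memvZ // -(addrK z (c *: y2)) -rE memvB //.
        by rewrite memv_span // !inE eqxx orbT.
      by rewrite !span_cons -[z]add0r memv_add ?mem0v // -[z]add0r memv_add ?mem0v.
    by rewrite memv_span // !inE vz !orbT.
  - move=> u v; rewrite !inE => /orP [] /eqP -> /orP [] /eqP ->; rewrite ?eqxx //.
      by rewrite amulE y1r scaler0.
    by rewrite mulC amulE y1r scaler0.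
  move=> u; rewrite !inE => /orP [] /eqP ->.
    by rewrite sq_by scaler_eq0 sqrf_eq0 negb_or b0.
  by rewrite sq_r scaler_eq0 sqrf_eq0 negb_or c0.
by apply/eqP; rewrite sq_r sq_by -addr_eq0 addrC isotropic.
Qed.

(* The square of [x] is isotropic for the diagonal form [sq] on the span of the
   [y_i], hence it lies in a hyperbolic plane, with orthogonal complement [g4]. *)
Lemma adapted_triple_neq0 fs t2 x y1 y2 y3 u b1 b2 b3 k :
  adapted mul fs (x :: t2) [:: y1; y2; y3] [:: u] ->
  sq x = b1 *: y1 + (b2 *: y2 + (b3 *: y3 + k *: u)) -> b1 != 0 ->
  exists g2 g3 g4, [/\ adapted mul fs (x :: t2) [:: g2; g3; g4] [:: u],
    sq x = g2 + g3 & sq g3 = - sq g2].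
Proof.
move=> ad xE b10; have xt : x \in x :: t2 := mem_head _ _.
have u_in : u \in <<[:: u]>>%VS by rewrite memv_span ?mem_head.
have mulu v : mul v u = 0 := adapted_ann v ad u_in.
have umul v : mul u v = 0 by rewrite mulC.
have u0 : u != 0.
  by have := adapted_free_zs ad; rewrite seq1_free.
have scaleu p q : p *: u = q *: u -> p = q.
  by move/eqP; rewrite -subr_eq0 -scalerBl scaler_eq0 (negbTE u0) orbF subr_eq0 => /eqP.
have /and3P [/and3P [/eqP y12 /eqP y13 _] /andP [/eqP y23 _] _] :=
  adapted_t1_pairwise ad.
have [y21 y31 y32] : [/\ mul y2 y1 = 0, mul y3 y1 = 0 & mul y3 y2 = 0].
  by rewrite mulC y12 mulC y13 mulC y23.
have [|c1 c10 sq1] := adapted_sq_line (x := y1) ad; first by rewrite !inE eqxx.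
have [|c2 c20 sq2] := adapted_sq_line (x := y2) ad; first by rewrite !inE eqxx orbT.
have [|c3 c30 sq3] := adapted_sq_line (x := y3) ad.
  by rewrite !inE eqxx !orbT.
pose products := (mulu, umul, y12, y13, y23, y21, y31, y32, sq1, sq2, sq3).
pose g2 := b1 *: y1; pose g3 := b2 *: y2 + (b3 *: y3 + k *: u).
pose g4 := (b3 * c3) *: y2 - (b2 * c2) *: y3.
have isotropic : b1 ^+ 2 * c1 + (b2 ^+ 2 * c2 + b3 ^+ 2 * c3) = 0.
  apply: scaleu; rewrite scale0r -(adapted_t2_mul ad xt xt) xE.
  rewrite !(amulE, products); vring.
pose d := b2 ^+ 2 * c2 + b3 ^+ 2 * c3.
have dE : d = - (b1 ^+ 2 * c1).
  by apply/eqP; rewrite -addr_eq0 addrC isotropic.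
have d0 : d != 0 by rewrite dE oppr_eq0 mulf_neq0 ?sqrf_eq0.
have sq_g2 : sq g2 = (- d) *: u.
  by rewrite dE opprK /g2 !(amulE, products); vring.
have sq_g3 : sq g3 = d *: u by rewrite /g3 !(amulE, products) /d; vring.
have sq_g4 : sq g4 = (c2 * c3 * d) *: u.
  by rewrite /g4 !(amulE, products) /d; vring.
have g23 : mul g2 g3 = 0 by rewrite /g2 /g3 !(amulE, products); vring.
have g24 : mul g2 g4 = 0 by rewrite /g2 /g4 !(amulE, products); vring.
have g34 : mul g3 g4 = 0 by rewrite /g3 /g4 !(amulE, products); vring.
have [g32 g42 g43] : [/\ mul g3 g2 = 0, mul g4 g2 = 0 & mul g4 g3 = 0].
  by rewrite mulC g23 mulC g24 mulC g34.
exists g2, g3, g4; split=> //; last by rewrite sq_g3 sq_g2 scaleNr opprK.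
(* Modulo u, the matrix of g3 and g4 on y2 and y3 has determinant -d, nonzero because isotropy makes
   d = - b1^2 c1; this inverts the change of basis. *)
have y1E : y1 = b1^-1 *: g2 by rewrite scalerK.
have y2E : y2 = d^-1 *: ((b2 * c2) *: g3 - (b2 * c2 * k) *: u + b3 *: g4).
  by apply: (scalerI d0); rewrite scalerA mulfV // scale1r /d /g3 /g4; vring.
have y3E : y3 = d^-1 *: ((b3 * c3) *: g3 - (b3 * c3 * k) *: u - b2 *: g4).
  by apply: (scalerI d0); rewrite scalerA mulfV // scale1r /d /g3 /g4; vring.
have mem_s (s : seq E) v : v \in s -> v \in <<s>>%VS by apply: memv_span.
apply: (adapted_t1_change mulC ad) => //.
- apply/eqP; rewrite eqEsubv; apply/andP; split; apply/span_subvP => v /=.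
    set s := [:: y1; y2; y3; u].
    have [] : [/\ y1 \in <<s>>%VS, y2 \in <<s>>%VS, y3 \in <<s>>%VS & u \in <<s>>%VS].
      by split; apply: mem_s; rewrite !inE eqxx ?orbT.
    move=> m1 m2 m3 mu; rewrite !inE => /or4P [] /eqP -> //.
    + exact: memvZ.
    + by rewrite !memvD ?memvZ.
    + by rewrite memvB ?memvZ.
  rewrite y1E y2E y3E; set s := [:: g2; g3; g4; u].
  have [] : [/\ g2 \in <<s>>%VS, g3 \in <<s>>%VS, g4 \in <<s>>%VS & u \in <<s>>%VS].
    by split; apply: mem_s; rewrite !inE eqxx ?orbT.
  move=> m2 m3 m4 mu; rewrite !inE => /or4P [] /eqP -> //.
  + exact: memvZ.
  + by rewrite memvZ // memvD ?memvB ?memvZ.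
  + by rewrite memvZ // !memvB ?memvZ.
- by move=> v w; rewrite !inE => /or3P [] /eqP -> /or3P [] /eqP ->; rewrite ?eqxx.
move=> v; rewrite !inE => /or3P [] /eqP ->;
  rewrite ?(sq_g2, sq_g3, sq_g4) scaler_eq0 (negbTE u0) orbF;
  by rewrite ?oppr_eq0 // !mulf_neq0.
Qed.

(** As x^2 is outside the span of u, one of its three coefficients on the y_i is nonzero; a
    permutation brings it to the front. *)
Lemma adapted_triple fs t2 x y1 y2 y3 u :
  adapted mul fs (x :: t2) [:: y1; y2; y3] [:: u] ->
  exists g2 g3 g4, [/\ adapted mul fs (x :: t2) [:: g2; g3; g4] [:: u],
    sq x = g2 + g3 & sq g3 = - sq g2].
Proof.
move=> ad; have xt : x \in x :: t2 := mem_head _ _.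
have [b1 [r r_in xE]] := mem_span_cons (adapted_t2_in ad xt).
have [b2 [r' r'_in rE]] := mem_span_cons r_in.
have [b3 [v /mem_span1P [k vE] r'E]] := mem_span_cons r'_in.
rewrite {}rE {}r'E {}vE in xE.
have [b10|] := eqVneq b1 0; last exact: adapted_triple_neq0 ad xE.
have [b20|b2_neq0] := eqVneq b2 0.
  have [b30|b3_neq0] := eqVneq b3 0.
    have := adapted_t2_notin ad xt; rewrite xE b10 b20 b30 !scale0r !add0r.
    by rewrite memvZ // memv_span ?mem_head.
  have p : perm_eq [:: y1; y2; y3] [:: y3; y1; y2] by apply/permP => P /=; lia.
  apply: (adapted_triple_neq0 (adapted_t1_perm mulC p ad) (b1 := b3) (b2 := b1)
    (b3 := b2) (k := k)) => //; rewrite xE; vring.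
have p : perm_eq [:: y1; y2; y3] [:: y2; y1; y3] by apply/permP => P /=; lia.
apply: (adapted_triple_neq0 (adapted_t1_perm mulC p ad) (b1 := b2) (b2 := b1)
  (b3 := b3) (k := k)) => //; rewrite xE; vring.
Qed.

(** A single y in [t1] would give x^2 = k y + z with k^2 y^2 = 0, so k = 0 and x^2 would be in the
    annihilator. The nonzero squares of [t1] need a nonzero annihilator. *)
Lemma adapted_t2_size fs x t2 t1 zs : adapted mul fs (x :: t2) t1 zs ->
  (1 < size t1)%N /\ (0 < size zs)%N.
Proof.
move=> ad; have xt : x \in x :: t2 := mem_head _ _.
have := adapted_t2_notin ad xt; have := adapted_t2_in ad xt.
have xx0 := adapted_t2_mul ad xt xt.
case: t1 ad => [|y [|y' t1]] ad; first by rewrite cat0s => ->.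
  move=> /mem_span_cons [k [z z_in xE]].
  have yt : y \in [:: y] := mem_head _ _.
  move: xx0; rewrite xE !amulE (mulC z) !(adapted_ann _ ad z_in) scaler0 !addr0.
  move=> /eqP; rewrite scaler_eq0 scaler_eq0 (negbTE (adapted_t1_neq0 ad yt)) orbF.
  by rewrite orbb => /eqP ->; rewrite scale0r add0r z_in.
move=> _ _; split=> //; case: zs ad {xx0} => // ad.
have yt : y \in [:: y, y' & t1] := mem_head _ _.
have := adapted_t1_in ad yt; rewrite span_nil memv0.
by rewrite (negbTE (adapted_t1_neq0 ad yt)).
Qed.

Lemma classified_t2_1 fs x t1 zs : adapted mul fs [:: x] t1 zs -> classified mul.
Proof.
move=> ad; have [t1_size zs_size] := adapted_t2_size ad.
have := adapted_size ad.
case: t1 t1_size ad => [|y1 [|y2 [|y3 [|y4 t1]]]] //= _ ad size5; try lia.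
  have [g2 [g3 [{}ad xE g3E]]] := adapted_pair ad.
  have [ws size_zs {}ad] := adapted_sq1 ad (mem_head _ _).
  case: fs ad size5 => [|f fs] ad /= size5.
    case: ws ad size_zs => [|w [|w' ws]] ad /= size_zs; try lia.
    by leaf ad (N7 F) x g2 g3 (sq g2) w.
  case: fs ws ad size_zs size5 => [|f' fs] [|w ws] ad /= size_zs size5; try lia.
  by leaf ad (E18 F) f x g2 g3 (sq g2).
case: fs zs zs_size ad size5 => [|f fs] [|z [|z' zs]] //= _ ad size5; try lia.
have [g2 [g3 [g4 [{}ad xE g3E]]]] := adapted_triple ad.
have [ws size_zs {}ad] := adapted_sq1 ad (mem_head _ _).
case: ws size_zs ad => // _ ad.
have [|k k0 g4E] := adapted_sq_line (x := g4) ad; first by rewrite !inE eqxx !orbT.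
leaf ad (N10 k0) x g2 g3 g4 (sq g2).
Qed.

(** Counting dimensions leaves two vectors in [t2], two in [t1] and one in [zs]. The square of x' is
    orthogonal to the isotropic vector x^2 = g2 + g3 of a hyperbolic plane, hence proportional to it
    modulo the annihilator. *)
Lemma classified_t2_2 fs x x' t2 t1 zs :
  adapted mul fs [:: x, x' & t2] t1 zs -> classified mul.
Proof.
move=> ad; have [t1_size zs_size] := adapted_t2_size ad.
have := adapted_size ad.
case: fs t2 t1 t1_size zs zs_size ad => [|f fs] [|x3 t2] [|y1 [|y2 [|y3 t1]]] //= _
  [|z [|z' zs]] //= _ ad size5; try lia.
have [g2 [g3 [{}ad xE g3E]]] := adapted_pair ad.
have [ws size_zs {}ad] := adapted_sq1 ad (mem_head _ _).
case: ws size_zs ad => // _ ad.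
have [xt x't] : x \in [:: x; x'] /\ x' \in [:: x; x'] by rewrite !inE !eqxx orbT.
have g2_neq0 : sq g2 != 0 by rewrite (adapted_t1_neq0 ad) ?mem_head.
have /and3P [/andP [/eqP g23 _] _ _] := adapted_t1_pairwise ad.
have [b [r /mem_span_cons [c [v v_in rE] x'E]]] := mem_span_cons (adapted_t2_in ad x't).
have bc : b = c.
  have := adapted_t2_mul ad xt x't; rewrite xE x'E rE !amulE !(adapted_ann _ ad v_in).
  rewrite g23 (mulC g3 g2) g23 g3E !scaler0 !addr0 add0r scalerN -scalerBl => /eqP.
  by rewrite scaler_eq0 (negbTE g2_neq0) orbF subr_eq0 => /eqP.
have [d vE] := mem_span1P v_in.
have {}x'E : sq x' = b *: (g2 + g3) + d *: sq g2.
  by rewrite x'E rE -bc vE scalerDr addrA.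
have b0 : b != 0.
  apply: contraNneq (adapted_t2_notin ad x't) => b0.
  by rewrite x'E b0 scale0r add0r memvZ // memv_span ?mem_head.
have [d0|d0] := eqVneq d 0.
  rewrite d0 scale0r addr0 in x'E.
  leaf ad (N11 b0) x g2 g3 x' (sq g2).
leaf ad (N12 b0 d0) x g2 g3 x' (sq g2).
Qed.

Lemma adapted_classification fs t2 t1 zs : adapted mul fs t2 t1 zs -> classified mul.
Proof.
case: t2 => [|x [|x' t2]]; last 2 first.
- exact: classified_t2_1.
- exact: classified_t2_2.
case: t1 => [|y1 [|y2 [|y3 [|y4 [|y5 t1]]]]].
- exact: classified_t1_0.
- exact: classified_t1_1.
- exact: classified_t1_2.
- exact: classified_t1_3.
- exact: classified_t1_4.
(* Five vectors in [t1] would exhaust the dimension and leave no room for their squares. *)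
move=> /adapted_sq1 /(_ (mem_head _ _)) [ws _].
by move=> /adapted_size /=; lia.
Qed.

End Classification.

(** * Invariants separating the families *)

Section Invariants.
Variables (F : fieldType) (E : vectType F) (mul : {bilinear E -> E -> E}).

(** The upper annihilating series, starting from the zero space at level 0. *)
Fixpoint ann_level (k : nat) (x : E) : Prop :=
  if k is k'.+1 then forall y, ann_level k' (mul x y) else x = 0.

Definition ann_dim (k d : nat) : Prop := exists2 U : {vspace E},
  forall x, x \in U <-> ann_level k x & \dim U = d.

Lemma ann_dim_unique k d d' : ann_dim k d -> ann_dim k d' -> d = d'.
Proof.
move=> [U memU <-] [U' memU' <-]; congr (\dim _); apply/vspaceP => x.
by apply/idP/idP; rewrite ?memU ?memU'.
Qed.

(** Means at least [m] lines, the upper bound being [has_lines_le]. Since the squares are nonzero,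
    the one-sided condition on pairs already makes the lines distinct. *)
Definition has_lines (m : nat) : Prop := exists2 xs : seq E, size xs = m &
  {in xs, forall x, mul x x != 0 /\ forall y, mul x y \in <[mul x x]>%VS} /\
  pairwise (fun x x' => mul x' x' \notin <[mul x x]>%VS) xs.

End Invariants.

Section Invariance.
Variables (F : fieldType) (E A : vectType F).
Variables (mulE : {bilinear E -> E -> E}) (mulA : {bilinear A -> A -> A}).
Variable f : 'Hom(E, A).
Hypotheses (f_bij : bijective f) (fM : forall x y, f (mulE x y) = mulA (f x) (f y)).

Let f_inj : injective f := bij_inj f_bij.

Lemma ann_level_iso k x : ann_level mulA k (f x) <-> ann_level mulE k x.
Proof.
elim: k x => [|k IHk] x /=; first by split=> [|->]; rewrite ?linear0 // -(linear0 f) => /f_inj.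
split=> [fx y|fx z]; first by apply/IHk; rewrite fM.
by have [g gK fgK] := f_bij; rewrite -(fgK z) -fM; apply/IHk.
Qed.

Lemma ann_dim_iso k d : ann_dim mulA k d -> ann_dim mulE k d.
Proof.
move=> [U memU <-]; exists (f @^-1: U)%VS => [x|].
  by rewrite -memv_preim; split=> [/memU|] /ann_level_iso // /memU.
have ker0 : lker f = 0%VS by apply/eqP/lker0P.
rewrite -(limg_dim_eq (f := f)) ?ker0 ?capv0 // lpreimK //.
apply/subvP => z _; have [g gK fgK] := f_bij.
by rewrite -(fgK z) memv_img ?memvf.
Qed.

Lemma line_iso x y : (f y \in <[f x]>)%VS = (y \in <[x]>)%VS.
Proof.
apply/vlineP/vlineP => -[k yE]; exists k; last by rewrite yE linearZ.
by apply: f_inj; rewrite yE linearZ.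
Qed.

Lemma has_lines_iso m : has_lines mulA m <-> has_lines mulE m.
Proof.
have [g gK fgK] := f_bij; split=> -[xs <- [lines pw]].
  have sqE x : mulA x x = f (mulE (g x) (g x)) by rewrite fM fgK.
  exists (map g xs); first by rewrite size_map.
  split.
    move=> _ /mapP [x /lines [xx0 line] ->]; split=> [|y].
      by apply: contraNneq xx0 => gx0; rewrite sqE gx0 linear0.
    by rewrite -line_iso -sqE fM fgK.
  rewrite pairwise_map; apply: sub_pairwise pw => x y /=.
  by rewrite !sqE line_iso.
exists (map f xs); first by rewrite size_map.
split.
  move=> _ /mapP [x /lines [xx0 line] ->]; rewrite -fM; split=> [|z].
    by rewrite -(linear0 f) (inj_eq f_inj).
  by rewrite -(fgK z) -fM line_iso.
by rewrite pairwise_map; apply: sub_pairwise pw => x y /=; rewrite -!fM line_iso.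
Qed.

End Invariance.

(** * Invariants of an algebra given by the squares of a natural basis *)

Section Evolution.
Variables (F : fieldType) (n : nat) (s : seq 'rV[F]_n).

Lemma evol_mul_delta (i : 'I_n) (x : 'rV[F]_n) :
  evol_mul s x (delta_mx 0 i) = x 0 i *: s`_i.
Proof.
rewrite /evol_mul (bigD1 i) //= mxE !eqxx mulr1 big1 ?addr0 // => j ji.
by rewrite mxE (negbTE ji) andbF mulr0 scale0r.
Qed.

Lemma evol_mul_delta2 (i : 'I_n) :
  evol_mul s (delta_mx 0 i) (delta_mx 0 i) = s`_i.
Proof. by rewrite evol_mul_delta mxE !eqxx scale1r. Qed.

Fixpoint level (k : nat) (i : 'I_n) : bool :=
  if k is k'.+1 then [forall j : 'I_n, (s`_i 0 j != 0) ==> level k' j] else false.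

(** From x e_i = x_i e_i^2, each term of the annihilating series is spanned by the basis vectors it
    contains, and these depend only on the supports of the squares. *)
Lemma ann_level_evol k (x : 'rV[F]_n) :
  ann_level (evol_mul s) k x <-> forall i, x 0 i != 0 -> level k i.
Proof.
elim: k x => [|k IHk] x /=.
  split=> [-> i|x0]; first by rewrite mxE eqxx.
  by apply/rowP => i; rewrite mxE; apply/eqP; apply/negPn/negP => /x0.
split=> [annx i xi|levx y].
  apply/forallP => j; apply/implyP => sij; have /IHk := annx (delta_mx 0 i).
  by apply; rewrite evol_mul_delta mxE mulf_neq0.
apply/IHk => j; rewrite /evol_mul summxE => sum_neq0.
have [i] : exists i : 'I_n, ((x 0 i * y 0 i) *: s`_i) 0 j != 0.
  apply/existsP; apply: contraNT sum_neq0; rewrite negb_exists => /forallP all0.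
  by rewrite big1 // => i _; apply/eqP/negPn/all0.
rewrite !mxE !mulf_eq0 !negb_or => /andP [/andP [xi _] sij].
by have /forallP /(_ j) /implyP := levx _ xi; apply.
Qed.

Lemma free_delta (p : pred 'I_n) :
  free [seq delta_mx 0 i : 'rV[F]_n | i <- enum p].
Proof.
have deltaI : free [seq delta_mx 0 i : 'rV[F]_n | i <- enum 'I_n].
  apply/(freeP (X := [tuple delta_mx 0 i : 'rV[F]_n | i < n])) => k k0 i.
  have nthE (j : 'I_n) : [tuple delta_mx 0 i : 'rV[F]_n | i < n]`_j = delta_mx 0 j.
    by rewrite -tnth_nth tnth_mktuple.
  have /rowP /(_ i) := k0; rewrite summxE mxE (bigD1 i) //= big1 => [|j ji].
    by rewrite addr0 nthE !mxE !eqxx mulr1.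
  by rewrite nthE !mxE [i == j]eq_sym (negbTE ji) mulr0.
apply: catl_free (_ : free (_ ++ [seq delta_mx 0 i | i <- enum (predC p)])).
have p_perm : perm_eq (enum p ++ enum (predC p)) (enum 'I_n).
  by rewrite !enumT /enum_mem; exact/permEl/perm_filterC.
by rewrite -map_cat (perm_free (perm_map _ p_perm)).
Qed.

Lemma ann_dim_evol k : ann_dim (evol_mul s) k #|level k|.
Proof.
pose X := [seq delta_mx 0 i : 'rV[F]_n | i <- enum (level k)].
exists <<X>>%VS; last by rewrite (eqP (free_delta _)) size_map -cardE.
move=> x; rewrite ann_level_evol; split=> [|xlev].
  move=> /(@coord_span _ _ _ (in_tuple _)) -> j; rewrite summxE => sum0.
  apply: contraNT sum0 => levj; rewrite big1 // => i _; rewrite !mxE.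
  have : (in_tuple X)`_i \in X by rewrite mem_nth.
  move=> /mapP [l]; rewrite mem_enum => levl ->; rewrite mxE.
  have jl : j != l by apply: contraNneq levj => ->; exact: levl.
  by rewrite (negbTE jl) andbF mulr0.
rewrite [x]row_sum_delta memv_suml // => i _.
have [->|xi] := eqVneq (x 0 i) 0; first by rewrite scale0r mem0v.
by rewrite memvZ // memv_span // map_f // mem_enum; apply: xlev.
Qed.

(** A basis vector always satisfies e_i y = y_i e_i^2, so every nonzero square of a basis vector
    gives a line. *)
Lemma has_lines_evol (r : seq 'I_n) :
  {in r, forall i : 'I_n, s`_i != 0} ->
  pairwise (fun i j : 'I_n => s`_j \notin <[s`_i]>%VS) r ->
  has_lines (evol_mul s) (size r).
Proof.
move=> r0 pw; exists [seq delta_mx 0 i | i <- r]; first by rewrite size_map.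
split.
  move=> _ /mapP [i ir ->]; rewrite /= evol_mul_delta2; split=> [|y]; first exact: r0.
  rewrite (_ : evol_mul s _ y = y 0 i *: s`_i) ?memvZ ?memv_line //.
  rewrite -evol_mul_delta /evol_mul; apply: eq_bigr => j _; congr (_ *: _).
  exact: mulrC.
by rewrite pairwise_map; apply: sub_pairwise pw => i j /=; rewrite !evol_mul_delta2.
Qed.

(** If x E is contained in the line of x^2 and x^2 is nonzero, some x e_i = x_i e_i^2 is nonzero, so
    x^2 lies on the line of e_i^2 and thus on that of some v in [vs]. Sending x to the index of the
    first such v is injective. *)
Lemma has_lines_le (vs : seq 'rV[F]_n) m :
  (forall i : 'I_n, has (fun v => s`_i \in <[v]>%VS) vs) ->
  has_lines (evol_mul s) m -> (m <= size vs)%N.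
Proof.
move=> cover [xs <- [lines pw]].
pose sq x := evol_mul s x x.
have sq_cover x : x \in xs -> has (fun v => sq x \in <[v]>%VS) vs.
  move=> /lines [sqx0 line].
  have [i xisi] : exists i : 'I_n, (x 0 i * x 0 i) *: s`_i != 0.
    apply/existsP; apply: contraNT sqx0; rewrite negb_exists => /forallP all0.
    by rewrite /= /evol_mul big1 // => i _; apply/eqP/negPn/all0.
  apply: sub_has (cover i) => v /vlineP [k sE].
  have := line (delta_mx 0 i); rewrite /= evol_mul_delta => /vlineP [l xE].
  have l0 : l != 0.
    by apply: contraNneq xisi => l0; rewrite -scalerA xE l0 scale0r scaler0.
  by rewrite -[sq x](scalerK l0) -xE sE !memvZ ?memv_line.
pose idx x := find (fun v => sq x \in <[v]>%VS) vs.
rewrite -(size_map idx xs) -(size_iota 0 (size vs)); apply: uniq_leq_size.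
  rewrite uniq_pairwise pairwise_map; apply: (sub_in_pairwise (P := mem xs)) pw.
    move=> x y xt yt; apply: contraNneq => idx_eq.
    have /(nth_find 0) := sq_cover _ yt; have /(nth_find 0) := sq_cover _ xt.
    rewrite -!/(idx _) /= idx_eq => /vlineP [k xE] /vlineP [l yE].
    have k0 : k != 0.
      have sqx0 : sq x != 0 := (lines _ xt).1.
      by apply: contraNneq sqx0 => k0; rewrite xE k0 scale0r.
    change (sq y \in <[sq x]>%VS).
    by rewrite yE memvZ // -(scalerK k0 vs`_(idx y)) -xE memvZ ?memv_line.
  exact/allP.
move=> _ /mapP [x xt ->]; rewrite mem_iota add0n /= /idx -has_find.
exact: sq_cover.
Qed.

End Evolution.

(* Indices, counted from 0, of the nonzero coordinates of the squares. *)
Definition supports (k : nat) : seq (seq nat) :=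
  match k with
  | 2 => [:: [:: 1]]
  | 3 => [:: [:: 2]; [:: 2]]
  | 4 => [:: [:: 1]; [::]; [:: 3]]
  | 5 => [:: [:: 3]; [:: 3]; [:: 3]]
  | 6 => [:: [:: 2]; [:: 2]; [::]; [:: 4]]
  | 7 => [:: [:: 1; 2]; [:: 3]; [:: 3]]
  | 8 => [:: [:: 4]; [:: 4]; [:: 4]; [:: 4]]
  | 9 => [:: [:: 3]; [:: 3; 4]; [:: 4]]
  | 10 => [:: [:: 1; 2]; [:: 4]; [:: 4]; [:: 4]]
  | 11 => [:: [:: 1; 2]; [:: 4]; [:: 4]; [:: 1; 2]]
  | 12 => [:: [:: 1; 2]; [:: 4]; [:: 4]; [:: 1; 2; 4]]
  | 13 => [:: [:: 0]]
  | 14 => [:: [:: 0]; [:: 2]]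
  | 15 => [:: [:: 0]; [:: 3]; [:: 3]]
  | 16 => [:: [:: 0]; [:: 2]; [::]; [:: 4]]
  | 17 => [:: [:: 0]; [:: 4]; [:: 4]; [:: 4]]
  | 18 => [:: [:: 0]; [:: 2; 3]; [:: 4]; [:: 4]]
  | 19 => [:: [:: 0]; [:: 1]]
  | 20 => [:: [:: 0]; [:: 1]; [:: 3]]
  | 21 => [:: [:: 0]; [:: 1]; [:: 4]; [:: 4]]
  | 22 => [:: [:: 0]; [:: 1]; [:: 2]]
  | 23 => [:: [:: 0]; [:: 1]; [:: 2]; [:: 4]]
  | 24 => [:: [:: 0]; [:: 1]; [:: 2]; [:: 3]]
  | 25 => [:: [:: 0]; [:: 1]; [:: 2]; [:: 3]; [:: 4]]
  | _ => [::]
  end%N.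

(* Indices of squares spanning all the lines spanned by squares, for the
   families that are not separated by the dimensions of the annihilators. *)
Definition representatives (k : nat) : seq nat :=
  match k with
  | 3 => [:: 0] | 4 => [:: 0; 2]
  | 5 => [:: 0] | 6 => [:: 0; 3] | 9 => [:: 0; 2; 1]
  | 11 => [:: 0; 1] | 12 => [:: 0; 1; 3]
  | 15 => [:: 0; 1] | 16 => [:: 0; 1; 3]
  | _ => [::]
  end%N.

(** Computable copy of [level] working on supports, so that the comparison of families is a closed
    computation. The default [[::]] stands for the zero squares beyond the end of the list. *)
Fixpoint level_nat (S : seq (seq nat)) (k i : nat) : bool :=
  if k is k'.+1 then all (level_nat S k') (nth [::] S i) else false.

Definition ann_count (k m : nat) : nat :=
  count (level_nat (supports k) m) (iota 0 5).

(** An empty list of representatives means that no number of lines is recorded, hence the two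
    nonemptiness conditions. *)
Definition separated (k k' : nat) : bool :=
  [|| k == k', ann_count k 1 != ann_count k' 1, ann_count k 2 != ann_count k' 2,
      ann_count k 3 != ann_count k' 3
    | [&& size (representatives k) != size (representatives k'),
          representatives k != [::] & representatives k' != [::]]].

Lemma all_separated : all2rel separated (iota 1 25).
Proof. by vm_compute. Qed.

(** * Invariants of the listed families *)

Section ListedInvariants.
Variable F : fieldType.
Implicit Types s : seq 'rV[F]_5.

Lemma listed_range k s : listed k s -> k \in iota 1 25.
Proof. by case. Qed.

(** The parameters being nonzero, the supports are the same throughout a family. *)
Lemma listed_supports k s : listed k s ->
  forall i j : 'I_5, (s`_i 0 j != 0) = (val j \in nth [::] (supports k) i).
Proof.
move=> ks i j; case: ks => *; case: i j => [[|[|[|[|[|?]]]]] ?] // [[|[|[|[|[|?]]]]] ?] //;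
  rewrite /= !mxE ?eqxx //=;
  by rewrite ?(mulr1, mulr0, addr0, add0r, oppr_eq0, oner_eq0, eqxx).
Qed.

Lemma listed_level k s m (i : 'I_5) : listed k s ->
  level s m i = level_nat (supports k) m i.
Proof.
move=> ks; have supp := listed_supports ks.
have supp_lt : all (all (fun j => j < 5)%N) (supports k).
  by case: ks.
elim: m i => //= m IHm i; apply/forallP/allP => [lev j ji|lev j].
  have j5 : (j < 5)%N.
    have [i_lt|i_ge] := ltnP i (size (supports k)); last by rewrite nth_default in ji.
    by have /allP/(_ _ (mem_nth [::] i_lt))/allP/(_ _ ji) := supp_lt.
  by have /implyP := lev (Ordinal j5); rewrite supp IHm; apply.
by apply/implyP; rewrite supp IHm; apply: lev.
Qed.

Lemma listed_ann_dim k s m : listed k s -> ann_dim (evol_mul s) m (ann_count k m).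
Proof.
move=> ks; suff <- : #|level s m| = ann_count k m by exact: ann_dim_evol.
rewrite cardE /enum_mem size_filter -enumT /ann_count -val_enum_ord count_map.
by apply: eq_count => i; rewrite /= -(listed_level _ _ ks).
Qed.

Lemma listed_cover k s (i : 'I_5) : listed k s -> representatives k != [::] ->
  has (fun v => s`_i \in <[v]>%VS) [seq s`_j | j <- representatives k].
Proof.
have lineZ a (v : 'rV[F]_5) : (a *: v \in <[v]>)%VS by rewrite memvZ ?memv_line.
case=> //= *; case: i => [[|[|[|[|[|?]]]]] ?] //=;
  by rewrite ?(mem0v, memvN, memv_line, lineZ, orbT).
Qed.

(** A square whose support is not contained in that of an earlier one is not a multiple of it. The
    order of the representatives is chosen for this: in family 9, the square with two nonzero
    coordinates comes last. *)
Lemma listed_independent k s : listed k s ->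
  [&& all (gtn 5) (representatives k),
      all (fun i => nth [::] (supports k) i != [::]) (representatives k)
    & pairwise (fun i j => has [predC nth [::] (supports k) i]
                               (nth [::] (supports k) j)) (representatives k)].
Proof. by case. Qed.

Lemma listed_lines k s m : listed k s -> representatives k != [::] ->
  has_lines (evol_mul s) (size (representatives k)) /\
  (has_lines (evol_mul s) m -> (m <= size (representatives k))%N).
Proof.
move=> ks rep0; split; last first.
  rewrite -(size_map (nth 0 s)); apply: has_lines_le => i; exact: listed_cover.
have supp := listed_supports ks.
have /and3P [lt5 nz indep] := listed_independent ks.
pose r : seq 'I_5 := [seq inord j | j <- representatives k].
have rE : map val r = representatives k.
  by rewrite -map_comp map_id_in // => j /(allP lt5) lt_j5; rewrite /= inordK.
have supp_lt (i : 'I_5) (j : nat) : j \in nth [::] (supports k) i -> (j < 5)%N.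
  have : all (all (gtn 5)) (supports k) by case: ks.
  have [i_lt|i_ge] := ltnP i (size (supports k)); last by rewrite nth_default.
  by move=> /allP/(_ _ (mem_nth [::] i_lt))/allP; apply.
rewrite -rE size_map; rewrite -rE in nz indep; apply: has_lines_evol.
  move=> i ir; have := allP nz _ (map_f val ir).
  case supp_i : (nth [::] (supports k) i) => [//|j l] _.
  have ji : j \in nth [::] (supports k) i by rewrite supp_i mem_head.
  have := supp i (Ordinal (supp_lt _ _ ji)); rewrite ji.
  by apply: contraTneq => ->; rewrite mxE eqxx.
rewrite pairwise_map in indep; apply: sub_pairwise indep => i i' /hasP [j ji' ji].
have j5 := supp_lt _ _ ji'; apply/vlineP => -[c s_i'].
have := supp i' (Ordinal j5); have := supp i (Ordinal j5).
rewrite ji' (negbTE (ji : j \notin _)) s_i' mxE => /negbFE /eqP ->.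
by rewrite mulr0 eqxx.
Qed.

End ListedInvariants.

(** Both sets of annihilator dimensions are those of [E], so [all_separated] leaves k = k' or
    different recorded numbers of lines. Carrying the lines of each model through [E] to the other
    bounds each number by the other. *)
Lemma listed_unique (F : fieldType) (E : vectType F)
    (mul : {bilinear E -> E -> E}) k k' (s s' : seq 'rV[F]_5) :
  listed k s -> listed k' s' -> alg_isomorphic mul (evol_mul s) ->
  alg_isomorphic mul (evol_mul s') -> k = k'.
Proof.
move=> ks ks' [f [f_bij fM]] [f' [f'_bij f'M]].
have ann m : ann_count k m = ann_count k' m.
  apply: (ann_dim_unique (mul := mul) (k := m)).
    exact (ann_dim_iso f_bij fM (listed_ann_dim m ks)).
  exact (ann_dim_iso f'_bij f'M (listed_ann_dim m ks')).
have := allrelP all_separated _ _ (listed_range ks) (listed_range ks').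
rewrite /separated !ann !eqxx => /or3P [/eqP //|//|/and3P [sizes r0 r0']].
have [has_r le_r] := listed_lines (size (representatives k')) ks r0.
have [has_r' le_r'] := listed_lines (size (representatives k)) ks' r0'.
case/negP: sizes; rewrite eqn_leq; apply/andP; split.
  by apply: le_r'; apply/(has_lines_iso f'_bij f'M)/(has_lines_iso f_bij fM).
by apply: le_r; apply/(has_lines_iso f_bij fM)/(has_lines_iso f'_bij f'M).
Qed.

Theorem proposition4p3p2 (F : fieldType) (char_neq2 : 2%N \notin [pchar F])
    (E : vectType F) (mul : {bilinear E -> E -> E})
    (dimE : \dim {:E} = 5%N)
    (evolE : evolution_algebra mul)
    (paE : power_associative mul) :
  exists! k : nat, exists s : seq 'rV[F]_5,
    listed k s /\ alg_isomorphic mul (evol_mul s).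
Proof.
have two_neq0 : 2%:R != 0 :> F by move: char_neq2; rewrite !inE.
have [b [b_basis b_orth]] := evolE.
have orth (i j : 'I_(size b)) : i != j -> mul b`_i b`_j = 0.
  by move=> ij; apply: b_orth.
have mulC := natural_mulC (X := in_tuple b) b_basis orth.
have quartic := power_associative_quartic paE.
have [fs [t2 [t1 [zs ad]]]] :=
  adapted_basis_exists (X := in_tuple b) b_basis orth two_neq0 quartic.
have [k [s ks]] := adapted_classification mulC dimE ad.
exists k; split; first by exists s.
by move=> k' [s' [ks' iso']]; apply: (listed_unique ks.1 ks' ks.2 iso').
Qed.
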